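(* Let $d\ge 1$, $\sigma>0$ and $K>0$. For any $K$-subgaussian distribution $P$ on $\mathbb{R}^d$ and every $n\in\mathbb{N}$, $$\mathbb{E}_{P^{\otimes n}}\,\mathsf{W}_1\big(\hat P_{S^n}\ast\mathcal{N}_\sigma,\;P\ast\mathcal{N}_\sigma\big)\;\le\; \sigma\sqrt{2d}\left(\frac{1}{\sqrt2}+\frac{K}{\sigma}\right)^{\frac d2+1}e^{\frac{3d}{16}}\,\frac{1}{\sqrt n}.$$
   Context: A distribution $P$ on $\mathbb{R}^d$ is $K$-subgaussian ($K>0$) if $X\sim P$ satisfies $\mathbb{E}\big[\exp(\alpha^T(X-\mathbb{E}X))\big]\le \exp\big(\tfrac12K^2\|\alpha\|^2\big)$ for all $\alpha\in\mathbb{R}^d$. $\mathcal{N}_\sigma=\mathcal{N}(0,\sigma^2\mathrm{I}_d)$; $S^n=(S_1,\dots,S_n)\sim P^{\otimes n}$ are i.i.d. samples from $P$; $\hat P_{S^n}=\frac1n\sum_{i=1}^n\delta_{S_i}$ is the empirical measure; $\ast$ is convolution of measures. $\mathsf{W}_1(\mu,\nu)=\inf\mathbb{E}\|X-Y\|$, the infimum being over all couplings of $X\sim\mu$ and $Y\sim\nu$, with $\|\cdot\|$ the Euclidean norm. *)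

(* Defs.v *)
From HB Require Import structures.
From mathcomp Require Import all_boot all_order all_algebra.
From mathcomp Require Import all_classical all_reals all_analysis.
From mathcomp Require Import measurable_realfun.

Set Implicit Arguments.
Unset Strict Implicit.
Unset Printing Implicit Defensive.

Import Order.TTheory GRing.Theory Num.Theory.
Import numFieldNormedType.Exports.

Local Open Scope classical_set_scope.
Local Open Scope ring_scope.

(* R^d is represented by [d.-tuple R] with the library's product sigma-algebra
   (generated by the coordinate maps), i.e. the Borel sigma-algebra of R^d. *)
Section euclidean.
Context {R : realType} {d : nat}.
Implicit Types x y : d.-tuple R.

Definition vadd x y : d.-tuple R := [tuple tnth x i + tnth y i | i < d].

Definition vsub x y : d.-tuple R := [tuple tnth x i - tnth y i | i < d].

Definition dotp x y : R := \sum_(i < d) tnth x i * tnth y i.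

Definition enorm x : R := Num.sqrt (\sum_(i < d) tnth x i ^+ 2).

Definition vaddp (z : d.-tuple R * d.-tuple R) : d.-tuple R := vadd z.1 z.2.

Lemma measurable_vaddp : measurable_fun setT vaddp.
Proof.
apply/measurable_fun_tnthP => i.
rewrite (_ : _ \o _ = (fun z => tnth z.1 i + tnth z.2 i)); last first.
  by apply/funext => z /=; rewrite tnth_mktuple.
by apply: measurable_funD;
  apply: (measurableT_comp (@measurable_tnth _ _ _ _)).
Qed.

HB.instance Definition _ := isMeasurableFun.Build _ _ _ _ vaddp measurable_vaddp.

End euclidean.

Section product_power.
Context {disp : measure_display} {T : measurableType disp} {R : realType}.

Definition tcons n (z : T * n.-tuple T) : n.+1.-tuple T :=
  [the n.+1.-tuple T of z.1 :: z.2].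

Lemma measurable_tcons n : measurable_fun setT (@tcons n).
Proof. exact: measurable_cons. Qed.

HB.instance Definition _ n :=
  isMeasurableFun.Build _ _ _ _ (@tcons n) (@measurable_tcons n).

(* the n-fold product measure, i.e. the law of n i.i.d. samples from P *)
Fixpoint prob_power (P : probability T R) n : probability (n.-tuple T) R :=
  match n with
  | 0 => [the probability _ _ of \d_([tuple] : 0.-tuple T)]
  | m.+1 => [the probability _ _ of
               distribution [the probability _ _ of (P \x prob_power P m)%E]
                            (@tcons m)]
  end.

End product_power.

Section empirical_measure.
Local Open Scope ereal_scope.
Context {disp : measure_display} {T : measurableType disp} {R : realType}.
Variables (n : nat) (s : n.-tuple T).

Definition empirical (A : set T) : \bar R :=
  (n%:R^-1)%:E * \sum_(i < n) \d_(tnth s i) A.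

Let empirical0 : empirical set0 = 0.
Proof. by rewrite /empirical big1 ?mule0// => i _; rewrite measure0. Qed.

Let empirical_ge0 A : 0 <= empirical A.
Proof.
apply: mule_ge0; first by rewrite lee_fin invr_ge0.
by apply: sume_ge0 => i _; exact: measure_ge0.
Qed.

Let empirical_sigma_additive : semi_sigma_additive empirical.
Proof.
pose m (k : nat) : {measure set T -> \bar R} :=
  if @insub _ _ 'I_n k is Some i then [the measure _ _ of \d_(tnth s i)]
  else [the measure _ _ of mzero].
have n0 : (0 <= n%:R^-1 :> R)%R by rewrite invr_ge0.
have E : empirical = mscale (NngNum n0) (msum m n).
  apply/funext => A; rewrite /empirical /mscale /msum /=; congr (_ * _).
  by apply: eq_bigr => i _; rewrite /m valK.
rewrite E; exact: measure_semi_sigma_additive.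
Qed.

HB.instance Definition _ := isMeasure.Build _ _ _ empirical
  empirical0 empirical_ge0 empirical_sigma_additive.

End empirical_measure.

(* The library puts [normal_prob] on [measurableTypeR R], an alias of R with the
   same (Borel) measurable sets but another display; it is moved to R along
   the identity *)
Definition of_measurableTypeR {R : realType} : measurableTypeR R -> R := idfun.

HB.instance Definition _ (R : realType) :=
  @isMeasurableFun.Build _ _ _ _ (@of_measurableTypeR R)
    (@measurable_id _ _ setT).

Section smoothing.
Context {R : realType} {d : nat}.

Section convolution.
Variables (mu : {measure set (d.-tuple R) -> \bar R})
  (nu : probability (d.-tuple R) R).

Definition convolution : set (d.-tuple R) -> \bar R :=
  pushforward (mu \x nu)%E vaddp.

Let measurable_preimage_vaddp (A : set (d.-tuple R)) :
  measurable A -> measurable (vaddp @^-1` A).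
Proof. by move=> mA; rewrite -[X in measurable X]setTI; exact: measurable_vaddp. Qed.

Let convolution0 : convolution set0 = 0%E.
Proof. by rewrite /convolution /pushforward preimage_set0 measure0. Qed.

Let convolution_ge0 A : (0 <= convolution A)%E.
Proof. exact: measure_ge0. Qed.

Let convolution_sigma_additive : semi_sigma_additive convolution.
Proof.
move=> F mF tF mUF; rewrite /convolution /pushforward preimage_bigcup.
apply: measure_semi_sigma_additive.
- by move=> k; exact: measurable_preimage_vaddp.
- apply/trivIsetP => /= i j _ _ ij; rewrite -preimage_setI.
  by move/trivIsetP : tF => /(_ _ _ _ _ ij) ->//; rewrite preimage_set0.
- by rewrite -preimage_bigcup; exact: measurable_preimage_vaddp.
Qed.

HB.instance Definition _ := isMeasure.Build _ _ _ convolution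
  convolution0 convolution_ge0 convolution_sigma_additive.

End convolution.

(* [normal_prob m s] has standard deviation s, so this is N(0, sigma^2 I_d):
   its coordinates are i.i.d. N(0, sigma^2) *)
Definition gaussian (sigma : R) : probability (d.-tuple R) R :=
  prob_power [the probability _ _ of
    distribution [the probability _ _ of normal_prob 0 sigma]
                 of_measurableTypeR] d.

Definition mean (P : probability (d.-tuple R) R) : d.-tuple R :=
  [tuple fine ('E_P[(fun x => tnth x i)])%E | i < d].

(* the first conjunct says that the mean E X exists *)
Definition subgaussian (K : R) (P : probability (d.-tuple R) R) : Prop :=
  (forall i, P.-integrable setT (fun x => (tnth x i)%:E)) /\
  (forall a : d.-tuple R,
    ('E_P[(fun x => expR (dotp a (vsub x (mean P))))]
       <= (expR (2^-1 * K ^+ 2 * enorm a ^+ 2))%:E)%E).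

Definition coupling (mu nu : {measure set (d.-tuple R) -> \bar R})
    (pi : probability (d.-tuple R * d.-tuple R)%type R) : Prop :=
  (forall A, measurable A -> pi (fst @^-1` A) = mu A) /\
  (forall A, measurable A -> pi (snd @^-1` A) = nu A).

Definition wasserstein1 (mu nu : {measure set (d.-tuple R) -> \bar R})
    : \bar R :=
  ereal_inf [set 'E_pi[(fun z => enorm (vsub z.1 z.2))]%E
            | pi in [set pi | coupling mu nu pi]].

End smoothing.

(* Main.v *)
Require Import Defs.
From HB Require Import structures.
From mathcomp Require Import all_boot all_order all_algebra.
From mathcomp Require Import all_classical all_reals all_analysis.
From mathcomp Require Import measurable_realfun.
From mathcomp Require Import ring lra.

(** Write [m] for the mean of [P], [s ^+ 2 = 2 * K ^+ 2 + sigma ^+ 2], and take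
    [gamma], the Gaussian law N(m, s^2 I), as reference measure. Let [phi x] be
    the density of N(x, sigma^2 I) with respect to [gamma]. The smoothed
    empirical measure and the smoothed [P] then have the densities
    [h_n = 1/n * sum_i (phi S_i)] and [h = E (phi X)].

    Leaving the common mass [min h_n h] in place and transporting the excess of
    [h_n] to the excess of [h] independently gives a coupling whose cost is at
    most the integral of [|z - m| * |h_n z - h z|] against [gamma]
    ([wasserstein1_le_density]). By Cauchy-Schwarz, the expected cost is at most
    the square root of the product of two quantities:
    - the integral of [|z - m| ^ 2], which is [d * s ^+ 2];
    - the expectation of the integral of [(h_n - h) ^ 2]. For fixed [z], [h_n z]
      is an average of [n] independent copies of [phi X z], so its variance is
      at most [E (phi X z) ^ 2 / n] ([integral_sqr_empirical_mean]).

    The integral of [(phi x) ^ 2] against [gamma] is a Gaussian integral equal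
    to a constant times [exp (|x - m| ^ 2 / (4 * K ^+ 2 + sigma ^+ 2))]. Its
    expectation is finite because [exp (b * |y| ^ 2)] is itself a Gaussian
    average of exponentials of linear forms in [y], which subgaussianity
    controls ([integral_subgaussian_expR_sqr]). The constants combine into
    [(s / sigma) ^+ d] ([integral_ratio_sqr_le]), so that the expected distance
    is at most [sqrt (d * s ^+ 2 * (s / sigma) ^+ d / n)]. With
    [w = 1 / sqrt 2 + K / sigma], the announced bound follows from
    [s <= sqrt 2 * w * sigma] and [sqrt 2 <= exp (3 / 8)].

    Below, the reference measure is centred at the origin, and the translation
    by [m] appears in the maps instead. *)

Set Implicit Arguments.
Unset Strict Implicit.
Unset Printing Implicit Defensive.

Import Order.TTheory GRing.Theory Num.Theory.
Import numFieldNormedType.Exports.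

Local Open Scope classical_set_scope.
Local Open Scope ring_scope.

(** * Integrals against measures with a density, and image measures *)

Section integral_generalities.
Context d (T : measurableType d) (R : realType).
Local Open Scope ereal_scope.
Import HBNNSimple.

(** The integral of a nonnegative function is a supremum over the simple
    functions below it, which is monotone without any measurability. This bounds
    integrals of functions whose measurability is not at hand, such as the
    Wasserstein distance as a function of the sample. *)
Lemma ge0_le_integralT (mu : {measure set T -> \bar R}) (f g : T -> \bar R) :
  (forall x, 0 <= f x) -> (forall x, f x <= g x) ->
  \int[mu]_x f x <= \int[mu]_x g x.
Proof.
move=> f0 fg; have g0 x : 0 <= g x by exact: le_trans (fg x).
rewrite !ge0_integralTE//; apply: ereal_sup_le => _ [h hf <-].
by exists h => // x; exact: le_trans (hf x) (fg x).
Qed.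

Variables (mu nu : {measure set T -> \bar R}) (g : T -> R).
Hypotheses (g0 : forall x, (0 <= g x)%R) (mg : measurable_fun setT g).
Hypothesis nuE : forall A, measurable A -> nu A = \int[mu]_(x in A) (g x)%:E.

Let mgE : measurable_fun setT (EFin \o g). Proof. exact/measurable_EFinP. Qed.

Let integral_density_indic (A : set T) : measurable A ->
  \int[nu]_x (\1_A x)%:E = \int[mu]_x ((\1_A x)%:E * (g x)%:E).
Proof.
move=> mA; rewrite integral_indic// setIT nuE// integral_mkcond.
apply: eq_integral => x _; rewrite patchE indicE.
by case: ifPn => xA; rewrite ?mul1e ?mul0e.
Qed.

Let integral_density_nnsfun (h : {nnsfun T >-> R}) :
  \int[nu]_x (h x)%:E = \int[mu]_x ((h x)%:E * (g x)%:E).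
Proof.
under [LHS]eq_integral do rewrite fimfunE -fsumEFin//.
rewrite [LHS]ge0_integral_fsum//; last 2 first.
  - by move=> r; exact/measurable_EFinP/measurableT_comp.
  - by move=> n x _; rewrite EFinM nnfun_muleindic_ge0.
under [RHS]eq_integral.
  move=> x xD; rewrite fimfunE -fsumEFin// ge0_mule_fsuml; last first.
    by move=> r; rewrite EFinM nnfun_muleindic_ge0.
  over.
rewrite [RHS]ge0_integral_fsum//; last 2 first.
  - move=> r; apply: emeasurable_funM => //.
    by apply/measurable_EFinP; apply: measurableT_comp => //.
  - move=> n x _; apply: mule_ge0; last by rewrite lee_fin.
    by rewrite EFinM nnfun_muleindic_ge0.
apply: eq_fsbigr => r /[!inE] -[t _ htr].
have r0 : (0 <= r)%R by rewrite -htr.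
have mr : measurable (h @^-1` [set r]) by [].
under eq_integral do rewrite EFinM.
under [RHS]eq_integral do rewrite EFinM -muleA.
rewrite !ge0_integralZl//.
- by rewrite integral_density_indic.
- by apply: emeasurable_funM => //; exact/measurable_EFinP.
- by move=> x _; rewrite mule_ge0// lee_fin.
- exact/measurable_EFinP.
Qed.

(** Clear for indicators, hence for simple functions, and then by monotone
    convergence; [g] takes finite values so that multiplication by [g x] commutes
    with limits in the extended reals. *)
Lemma ge0_integral_density (f : T -> \bar R) :
  (forall x, 0 <= f x) -> measurable_fun setT f ->
  \int[nu]_x f x = \int[mu]_x (f x * (g x)%:E).
Proof.
move=> f0 mf; pose f_ := nnsfun_approx measurableT mf.
have cvf x : (f_ n x)%:E @[n --> \oo] --> f x by exact: cvg_nnsfun_approx.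
have ndf x : {homo (fun n => (f_ n x)%:E) : m n / (m <= n)%N >-> m <= n}.
  by move=> m n mn; rewrite lee_fin; exact/lefP/nd_nnsfun_approx.
transitivity (limn (fun n => \int[nu]_x (f_ n x)%:E)).
  rewrite -monotone_convergence//=.
  - by apply: eq_integral => x _; apply/esym/cvg_lim.
  - by move=> n; exact/measurable_EFinP/measurable_funTS.
  - by move=> n x _; rewrite lee_fin.
under eq_fun do rewrite integral_density_nnsfun.
rewrite -monotone_convergence//=.
- apply: eq_integral => x _; apply/cvg_lim => //.
  by apply: cvgeZr => //; exact: cvf.
- by move=> n; apply: emeasurable_funM => //; exact/measurable_EFinP.
- by move=> n x _; rewrite mule_ge0 ?lee_fin.
- by move=> x _ m n mn; rewrite lee_wpmul2r ?lee_fin//; exact: ndf.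
Qed.

End integral_generalities.

Section weighted_measure.
Context d (T : measurableType d) (R : realType).
Local Open Scope ereal_scope.
Variables (mu : {measure set T -> \bar R}) (g : T -> R).

(** The proofs are arguments so that a measure structure can be inferred from
    the term alone. *)
Definition weighted (g0 : forall x, (0 <= g x)%R)
    (mg : measurable_fun setT g) (A : set T) : \bar R :=
  \int[mu]_(x in A) (g x)%:E.

Variables (g0 : forall x, (0 <= g x)%R) (mg : measurable_fun setT g).

Let weighted0 : weighted g0 mg set0 = 0.
Proof. by rewrite /weighted integral_set0. Qed.

Let weighted_ge0 A : 0 <= weighted g0 mg A.
Proof. by apply: integral_ge0 => x _; rewrite lee_fin. Qed.

Let weighted_sigma_additive : semi_sigma_additive (weighted g0 mg).
Proof.
move=> F mF tF mUF; rewrite /weighted ge0_integral_bigcup//.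
- by apply: is_cvg_ereal_nneg_natsum_cond => n _ _; exact: weighted_ge0.
- by apply/measurable_EFinP; exact: measurable_funTS.
- by move=> x _; rewrite lee_fin.
Qed.

HB.instance Definition _ := isMeasure.Build _ _ _ (weighted g0 mg)
  weighted0 weighted_ge0 weighted_sigma_additive.

Lemma ge0_integral_weighted (f : T -> \bar R) :
  (forall x, 0 <= f x) -> measurable_fun setT f ->
  \int[weighted g0 mg]_x f x = \int[mu]_x (f x * (g x)%:E).
Proof. by move=> f0 mf; apply: ge0_integral_density. Qed.

End weighted_measure.

Section image_measure.
Context d d' (T : measurableType d) (T' : measurableType d') (R : realType).
Local Open Scope ereal_scope.
Variables (mu : {measure set T -> \bar R}) (phi : T -> T').

(** As for [weighted], the proof argument lets a measure structure be inferred. *)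
Definition image_measure (mphi : measurable_fun setT phi) : set T' -> \bar R :=
  pushforward mu phi.

Hypothesis mphi : measurable_fun setT phi.

Let image0 : image_measure mphi set0 = 0.
Proof. by rewrite /image_measure /pushforward preimage_set0 measure0. Qed.

Let image_ge0 A : 0 <= image_measure mphi A.
Proof. exact: measure_ge0. Qed.

Let image_sigma_additive : semi_sigma_additive (image_measure mphi).
Proof. by apply: measure_semi_sigma_additive; exact: mphi. Qed.

HB.instance Definition _ := isMeasure.Build _ _ _ (image_measure mphi)
  image0 image_ge0 image_sigma_additive.

Lemma ge0_integral_image (f : T' -> \bar R) :
  (forall x, 0 <= f x) -> measurable_fun setT f ->
  \int[image_measure mphi]_y f y = \int[mu]_x f (phi x).
Proof. by move=> f0 mf; rewrite ge0_integral_pushforward. Qed.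

End image_measure.

Lemma mnormalize_mass1 d (T : measurableType d) (R : realType)
    (mu : {measure set T -> \bar R}) (P : probability T R) :
  mu setT = 1%E -> mnormalize mu P = mu.
Proof.
by move=> mu1; apply/funext => A; rewrite /mnormalize mu1 onee_eq0/= invr1 mule1.
Qed.

(** * Euclidean vectors *)

Section euclidean_lemmas.
Context {R : realType} {d : nat}.
Implicit Types x y z : d.-tuple R.

Lemma enorm_ge0 x : 0 <= enorm x. Proof. exact: sqrtr_ge0. Qed.

Lemma enorm_sqr x : enorm x ^+ 2 = \sum_(i < d) tnth x i ^+ 2.
Proof. by rewrite sqr_sqrtr// sumr_ge0// => i _; exact: sqr_ge0. Qed.

Lemma enorm_vsubxx x : enorm (vsub x x) = 0.
Proof.
by rewrite /enorm big1 ?sqrtr0// => i _; rewrite tnth_mktuple subrr expr0n.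
Qed.

Lemma vsub_vadd2r x y z : vsub (vadd x z) (vadd y z) = vsub x y.
Proof. by apply: eq_from_tnth => i; rewrite !tnth_mktuple; ring. Qed.

(** The two-vector identity [|M x + N y|^2 >= 0], with [N = |x|] and [M = |y|],
    gives Cauchy-Schwarz, hence the triangle inequality. *)
Lemma enorm_vsub_le x y : enorm (vsub x y) <= enorm x + enorm y.
Proof.
set N := enorm x; set M := enorm y.
have N0 : 0 <= N by exact: enorm_ge0.
have M0 : 0 <= M by exact: enorm_ge0.
have sumxy : - (N * M) <= \sum_(i < d) tnth x i * tnth y i.
  have : 0 <= \sum_(i < d) (M * tnth x i + N * tnth y i) ^+ 2.
    by apply: sumr_ge0 => i _; exact: sqr_ge0.
  rewrite (_ : \sum_(i < d) _ = M ^+ 2 * (\sum_(i < d) tnth x i ^+ 2) +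
      N ^+ 2 * (\sum_(i < d) tnth y i ^+ 2) +
      2 * (N * M) * \sum_(i < d) tnth x i * tnth y i); last first.
    rewrite !mulr_sumr -!big_split/=.
    by apply: eq_bigr => i _; ring.
  rewrite -!enorm_sqr -/N -/M; have [NM0|NM0] := eqVneq (N * M) 0; last first.
    have NMgt0 : 0 < N * M by rewrite lt_def NM0 mulr_ge0.
    rewrite (_ : _ + _ + _ = 2 * (N * M) * (N * M + \sum_(i < d) tnth x i * tnth y i)).
      by rewrite (pmulr_rge0 _ (mulr_gt0 (ltr0Sn R 1) NMgt0)) => ?; lra.
    by ring.
  move=> _; have xy0 i : tnth x i * tnth y i = 0.
    have zero z : enorm z = 0 -> tnth z i = 0.
      move=> z0; apply/eqP; rewrite -sqrf_eq0.
      move/(congr1 (fun r => r ^+ 2)) : z0; rewrite enorm_sqr expr0n/=.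
      move/eqP; rewrite psumr_eq0; last by move=> j _; exact: sqr_ge0.
      by move=> /allP/(_ i (mem_index_enum _)).
    move/eqP : NM0; rewrite mulf_eq0 => /orP[] /eqP /zero ->.
      by rewrite mul0r.
    by rewrite mulr0.
  by rewrite NM0 oppr0 big1.
rewrite -(@ler_pXn2r _ 2)// ?nnegrE ?addr_ge0 ?enorm_ge0//.
have -> : enorm (vsub x y) ^+ 2 =
    N ^+ 2 + (- 2) * (\sum_(i < d) tnth x i * tnth y i) + M ^+ 2.
  rewrite /N /M !enorm_sqr mulr_sumr -!big_split/=.
  by apply: eq_bigr => i _; rewrite tnth_mktuple; ring.
rewrite sqrrD -mulr_natl; lra.
Qed.

Lemma measurable_enorm : measurable_fun setT (@enorm R d).
Proof.
apply: (@measurableT_comp _ _ _ _ _ _ (@Num.sqrt R)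
  _ (fun x : d.-tuple R => \sum_(i < d) tnth x i ^+ 2)).
  exact: continuous_measurable_fun (@sqrt_continuous R).
by apply: measurable_sum => i; apply: measurable_funX; exact: measurable_tnth.
Qed.

Lemma measurable_vsub d' (T : measurableType d') (f g : T -> d.-tuple R) :
  measurable_fun setT f -> measurable_fun setT g ->
  measurable_fun setT (fun t => vsub (f t) (g t)).
Proof.
move=> mf mg; apply/measurable_fun_tnthP => i.
rewrite [X in measurable_fun _ X](_ : _ = fun t => tnth (f t) i - tnth (g t) i).
  by apply: measurable_funB; 
    apply: (measurableT_comp (@measurable_tnth _ _ _ _)).
by apply/funext => t /=; rewrite tnth_mktuple.
Qed.

Lemma measurable_vadd d' (T : measurableType d') (f g : T -> d.-tuple R) :
  measurable_fun setT f -> measurable_fun setT g ->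
  measurable_fun setT (fun t => vadd (f t) (g t)).
Proof.
move=> mf mg; apply: (measurableT_comp measurable_vaddp (g := fun t => (f t, g t))).
exact: measurable_fun_pair.
Qed.

End euclidean_lemmas.

(** * A coupling of two measures given by densities *)

Section density_coupling.
Context {R : realType} {d : nat}.
Local Notation T := (d.-tuple R).
Local Open Scope ereal_scope.
Variables (gam : probability T R) (m : T) (h1 h2 : T -> R).
Hypotheses (h10 : forall z, (0 <= h1 z)%R) (h20 : forall z, (0 <= h2 z)%R).
Hypotheses (mh1 : measurable_fun setT h1) (mh2 : measurable_fun setT h2).
Hypotheses (int_h1 : \int[gam]_z (h1 z)%:E = 1).
Hypotheses (int_h2 : \int[gam]_z (h2 z)%:E = 1).

Let u z : R := Num.max (h1 z - h2 z)%R 0%R.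
Let v z : R := Num.max (h2 z - h1 z)%R 0%R.
Let w z : R := Num.min (h1 z) (h2 z).

Let uw z : (u z + w z)%R = h1 z.
Proof.
rewrite /u /w; have [h|h] := leP (h1 z) (h2 z).
  by rewrite max_r ?subr_le0// add0r.
by rewrite max_l ?subr_ge0 1?ltW//; ring.
Qed.

Let vw z : (v z + w z)%R = h2 z.
Proof.
rewrite /v /w; have [h|h] := leP (h1 z) (h2 z).
  by rewrite max_l ?subr_ge0//; ring.
by rewrite max_r ?subr_le0 1?ltW// add0r.
Qed.

Let uv z : (u z + v z)%R = `|h1 z - h2 z|%R.
Proof.
rewrite /u /v; have [h|h] := leP (h1 z) (h2 z).
  rewrite max_r ?subr_le0// max_l ?subr_ge0// add0r distrC ger0_norm//.
  by rewrite subr_ge0.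
rewrite max_l ?subr_ge0 1?ltW// max_r ?subr_le0 1?ltW// addr0 gtr0_norm//.
by rewrite subr_gt0.
Qed.

Let u0 z : (0 <= u z)%R. Proof. by rewrite le_max lexx orbT. Qed.
Let v0 z : (0 <= v z)%R. Proof. by rewrite le_max lexx orbT. Qed.
Let w0 z : (0 <= w z)%R. Proof. by rewrite le_min h10 h20. Qed.

Let meas_u : measurable_fun setT u.
Proof. by apply: measurable_maxr => //; exact: measurable_funB. Qed.
Let meas_v : measurable_fun setT v.
Proof. by apply: measurable_maxr => //; exact: measurable_funB. Qed.
Let meas_w : measurable_fun setT w. Proof. exact: measurable_minr. Qed.

Let intuw : \int[gam]_z (u z)%:E + \int[gam]_z (w z)%:E = 1.
Proof.
rewrite -ge0_integralD//; do ?[by move=> ? _; rewrite lee_fin|exact/measurable_EFinP].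
by rewrite -int_h1; apply: eq_integral => z _; rewrite -EFinD uw.
Qed.

Let intvw : \int[gam]_z (v z)%:E + \int[gam]_z (w z)%:E = 1.
Proof.
rewrite -ge0_integralD//; do ?[by move=> ? _; rewrite lee_fin|exact/measurable_EFinP].
by rewrite -int_h2; apply: eq_integral => z _; rewrite -EFinD vw.
Qed.

Let dlt : R := fine (\int[gam]_z (u z)%:E).

Let intu : \int[gam]_z (u z)%:E = dlt%:E.
Proof.
rewrite fineK// ge0_fin_numE; last by apply: integral_ge0 => z _; rewrite lee_fin.
apply: (@le_lt_trans _ _ 1); last exact: ltry.
by rewrite -intuw leeDl//; apply: integral_ge0 => z _; rewrite lee_fin.
Qed.

Let intv : \int[gam]_z (v z)%:E = dlt%:E.
Proof.
have Wfin : \int[gam]_z (w z)%:E \is a fin_num.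
  rewrite ge0_fin_numE; last by apply: integral_ge0 => z _; rewrite lee_fin.
  apply: (@le_lt_trans _ _ 1); last exact: ltry.
  by rewrite -intuw leeDr//; apply: integral_ge0 => z _; rewrite lee_fin.
by rewrite -[LHS](addeK _ Wfin) intvw -intuw addeK.
Qed.

Let dlt0 : (0 <= dlt)%R.
Proof. by rewrite -lee_fin -intu integral_ge0// => z _; rewrite lee_fin. Qed.

Let mdiag : measurable_fun setT (fun z : T => (vadd z m, vadd z m)).
Proof. by apply: measurable_fun_pair; exact: measurable_vadd. Qed.

Let mpair : measurable_fun setT (fun z : T * T => (vadd z.1 m, vadd z.2 m)).
Proof. by apply: measurable_fun_pair; exact: measurable_vadd. Qed.

Let k0 z : (0 <= dlt^-1 * u z.1 * v z.2)%R.
Proof. by rewrite !mulr_ge0 ?invr_ge0. Qed.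

Let mk : measurable_fun setT (fun z : T * T => dlt^-1 * u z.1 * v z.2)%R.
Proof.
apply: measurable_funM.
  by apply: measurable_funM => //; exact: measurableT_comp.
by apply: (measurableT_comp meas_v measurable_snd).
Qed.

(** The common part [min h1 h2] stays on the diagonal; the excess [u] of [h1]
    is transported to the excess [v] of [h2] by the product measure, [dlt] being
    the mass of both. When [dlt = 0] the inverse is [0] and only the diagonal
    part remains. *)
Let rho := measure_add
  (image_measure (weighted gam w0 meas_w) mdiag)
  (image_measure (weighted (gam \x gam) k0 mk) mpair).

Let int_rho (F : T * T -> \bar R) :
    (forall z, 0 <= F z) -> measurable_fun setT F ->
  \int[rho]_z F z = \int[gam]_z (F (vadd z m, vadd z m) * (w z)%:E) +
    \int[gam]_x \int[gam]_y
      (F (vadd x m, vadd y m) * (dlt^-1 * u x * v y)%:E).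
Proof.
move=> F0 mF; rewrite ge0_integral_measure_add//; congr (_ + _).
  rewrite ge0_integral_image// ge0_integral_weighted//.
  exact: (measurableT_comp mF mdiag).
rewrite ge0_integral_image// ge0_integral_weighted//; last first.
  exact: (measurableT_comp mF mpair).
rewrite fubini_tonelli1//.
  apply: emeasurable_funM; last exact/measurable_EFinP.
  exact: (measurableT_comp mF mpair).
by move=> z; rewrite mule_ge0 ?lee_fin.
Qed.

(* an equality unless [dlt = 0], in which case [dlt^-1 = 0] *)
Let dltV_le1 : (dlt^-1 * dlt <= 1)%R.
Proof.
have [->|d0] := eqVneq dlt 0%R; first by rewrite mulr0.
by rewrite mulVf.
Qed.

(* when [dlt = 0] the excess is zero almost everywhere and both sides vanish *)
Let int_excess (g : T -> R) (f : T -> R) :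
    \int[gam]_z (g z)%:E = dlt%:E -> (forall z, (0 <= g z)%R) ->
    measurable_fun setT g -> measurable_fun setT f ->
    (forall z, (0 <= f z <= 1)%R) ->
  (dlt^-1 * dlt)%:E * \int[gam]_z (f z * g z)%:E = \int[gam]_z (f z * g z)%:E.
Proof.
move=> intg g0 mg mf f01; have [d0|d0] := eqVneq dlt 0%R; last first.
  by rewrite mulVf// mul1e.
suff -> : \int[gam]_z (f z * g z)%:E = 0 by rewrite mule0.
apply/eqP; rewrite eq_le; apply/andP; split.
  rewrite -[leRHS]/(0%:E) -d0 -intg; apply: ge0_le_integralT => z.
    by rewrite lee_fin mulr_ge0//; case/andP : (f01 z).
  by rewrite lee_fin ler_piMl//; case/andP : (f01 z).
by apply: integral_ge0 => z _; rewrite lee_fin mulr_ge0//; case/andP : (f01 z).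
Qed.

Let measurable_shift_indic (A : set T) : measurable A ->
  measurable_fun setT (fun z : T => \1_A (vadd z m) : R).
Proof.
move=> mA; apply: (@measurableT_comp _ _ _ _ _ _ (\1_A : T -> R) _
  (fun z : T => vadd z m)); first exact: measurable_indic.
exact: measurable_vadd.
Qed.

Let indic01 (A : set T) (z : T) : (0 <= (\1_A z : R) <= 1)%R.
Proof. by rewrite indicE; case: (_ \in _); rewrite /= ?ler01 lexx. Qed.

Let int_fst (f : T -> R) : measurable_fun setT f ->
    (forall z, (0 <= f z)%R) ->
  \int[gam]_x \int[gam]_y (f x * (dlt^-1 * u x * v y))%:E =
  (dlt^-1 * dlt)%:E * \int[gam]_z (f z * u z)%:E.
Proof.
move=> mf f0.
rewrite -ge0_integralZl_EFin//; last 3 first.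
- by move=> z _; rewrite lee_fin mulr_ge0.
- by apply/measurable_EFinP; exact: measurable_funM.
- by rewrite mulr_ge0 ?invr_ge0.
apply: eq_integral => x _.
under eq_integral do rewrite !mulrA EFinM.
rewrite ge0_integralZl_EFin//; last 3 first.
- by move=> y _; rewrite lee_fin.
- exact/measurable_EFinP.
- by rewrite !mulr_ge0 ?invr_ge0.
by rewrite intv -!EFinM; congr EFin; ring.
Qed.

Let int_snd (f : T -> R) : measurable_fun setT f ->
    (forall z, (0 <= f z)%R) ->
  \int[gam]_x \int[gam]_y (f y * (dlt^-1 * u x * v y))%:E =
  (dlt^-1 * dlt)%:E * \int[gam]_z (f z * v z)%:E.
Proof.
move=> mf f0.
transitivity (\int[gam]_x ((dlt^-1 * u x)%:E * \int[gam]_z (f z * v z)%:E)).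
  apply: eq_integral => x _; rewrite -ge0_integralZl_EFin//; last 3 first.
  - by move=> z _; rewrite lee_fin mulr_ge0.
  - by apply/measurable_EFinP; exact: measurable_funM.
  - by rewrite mulr_ge0 ?invr_ge0.
  by apply: eq_integral => y _; rewrite -EFinM; congr EFin; ring.
rewrite ge0_integralZr//; last 3 first.
- by apply/measurable_EFinP; exact: measurable_funM.
- by move=> x _; rewrite lee_fin mulr_ge0 ?invr_ge0.
- by apply: integral_ge0 => z _; rewrite lee_fin mulr_ge0.
congr (_ * _); under eq_integral do rewrite EFinM.
rewrite ge0_integralZl_EFin//.
- by rewrite intu.
- by move=> x _; rewrite lee_fin.
- exact/measurable_EFinP.
- by rewrite invr_ge0.
Qed.

Let marginal1 (A : set T) : measurable A ->
  rho (fst @^-1` A) = \int[gam]_z ((\1_A (vadd z m))%:E * (h1 z)%:E).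
Proof.
move=> mA; have mI := measurable_shift_indic mA.
have mA1 : measurable (fst @^-1` A : set (T * T)).
  by rewrite -[X in measurable X]setTI; exact: measurable_fst.
transitivity (\int[rho]_z (\1_(fst @^-1` A : set (T * T)) z)%:E).
  by rewrite integral_indic// setIT.
rewrite int_rho//; last by apply/measurable_EFinP; exact: measurable_indic.
under [X in _ + X]eq_integral do under eq_integral do rewrite -EFinM.
rewrite (int_fst mI)// (int_excess intu)// -ge0_integralD//; last 4 first.
- by move=> z _; rewrite mule_ge0 ?lee_fin.
- by apply: emeasurable_funM; apply/measurable_EFinP.
- by move=> z _; rewrite lee_fin mulr_ge0.
- by apply/measurable_EFinP; exact: measurable_funM.
by apply: eq_integral => z _; rewrite -!EFinM -EFinD -uw /=; congr EFin; ring.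
Qed.

Let marginal2 (A : set T) : measurable A ->
  rho (snd @^-1` A) = \int[gam]_z ((\1_A (vadd z m))%:E * (h2 z)%:E).
Proof.
move=> mA; have mI := measurable_shift_indic mA.
have mA2 : measurable (snd @^-1` A : set (T * T)).
  by rewrite -[X in measurable X]setTI; exact: measurable_snd.
transitivity (\int[rho]_z (\1_(snd @^-1` A : set (T * T)) z)%:E).
  by rewrite integral_indic// setIT.
rewrite int_rho//; last by apply/measurable_EFinP; exact: measurable_indic.
under [X in _ + X]eq_integral do under eq_integral do rewrite -EFinM.
rewrite (int_snd mI)// (int_excess intv)// -ge0_integralD//; last 4 first.
- by move=> z _; rewrite mule_ge0 ?lee_fin.
- by apply: emeasurable_funM; apply/measurable_EFinP.
- by move=> z _; rewrite lee_fin mulr_ge0.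
- by apply/measurable_EFinP; exact: measurable_funM.
by apply: eq_integral => z _; rewrite -!EFinM -EFinD -vw /=; congr EFin; ring.
Qed.

(* the diagonal part costs nothing; on the product part the distance is bounded
   by the sum of the norms, which the two marginals integrate separately *)
Let cost : \int[rho]_z (enorm (vsub z.1 z.2))%:E <=
  \int[gam]_z (enorm z * `|h1 z - h2 z|)%:E.
Proof.
have mn := @measurable_enorm R d.
rewrite int_rho//; last 2 first.
- by move=> z; rewrite lee_fin enorm_ge0.
- apply/measurable_EFinP; apply: (measurableT_comp mn).
  exact: (measurable_vsub measurable_fst measurable_snd).
under eq_integral do rewrite enorm_vsubxx mul0e.
rewrite integral0 add0e.
apply: (@le_trans _ _ (\int[gam]_x \int[gam]_y
    ((enorm x * (dlt^-1 * u x * v y))%:E + (enorm y * (dlt^-1 * u x * v y))%:E))).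
  apply: ge0_le_integralT => x.
    by apply: integral_ge0 => y _; rewrite -EFinM lee_fin !mulr_ge0 ?invr_ge0 ?enorm_ge0.
  apply: ge0_le_integralT => y.
    by rewrite -EFinM lee_fin !mulr_ge0 ?invr_ge0 ?enorm_ge0.
  rewrite vsub_vadd2r -EFinM -EFinD lee_fin -mulrDl ler_wpM2r ?enorm_vsub_le//.
  by rewrite !mulr_ge0 ?invr_ge0.
under eq_integral => x _.
  rewrite ge0_integralD//; last 4 first.
  - by move=> y _; rewrite lee_fin !mulr_ge0 ?invr_ge0 ?enorm_ge0.
  - by apply/measurable_EFinP; do 2 apply: measurable_funM => //.
  - by move=> y _; rewrite lee_fin !mulr_ge0 ?invr_ge0 ?enorm_ge0.
  - by apply/measurable_EFinP; do 2 apply: measurable_funM => //.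
  over.
have mF (f : T * T -> R) : measurable_fun setT f -> (forall z, (0 <= f z)%R) ->
    measurable_fun setT (fun x => \int[gam]_y (f (x, y))%:E).
  move=> mf f0; apply: (measurable_fun_fubini_tonelli_F (fun z => (f z)%:E)) => //.
  exact/measurable_EFinP.
rewrite ge0_integralD//; last 4 first.
- by move=> x _; apply: integral_ge0 => y _;
    rewrite lee_fin !mulr_ge0 ?invr_ge0 ?enorm_ge0.
- apply: (mF (fun z => enorm z.1 * (dlt^-1 * u z.1 * v z.2))%R).
    by apply: measurable_funM => //; exact: (measurableT_comp mn measurable_fst).
  by move=> z; rewrite !mulr_ge0 ?invr_ge0 ?enorm_ge0.
- by move=> x _; apply: integral_ge0 => y _;
    rewrite lee_fin !mulr_ge0 ?invr_ge0 ?enorm_ge0.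
- apply: (mF (fun z => enorm z.2 * (dlt^-1 * u z.1 * v z.2))%R).
    by apply: measurable_funM => //; exact: (measurableT_comp mn measurable_snd).
  by move=> z; rewrite !mulr_ge0 ?invr_ge0 ?enorm_ge0.
rewrite (int_fst mn) ?(int_snd mn); last 2 first.
- by move=> z; rewrite enorm_ge0.
- by move=> z; rewrite enorm_ge0.
have n0 (g : T -> R) : (forall z, (0 <= g z)%R) ->
    0 <= \int[gam]_z (enorm z * g z)%:E.
  by move=> g0; apply: integral_ge0 => z _; rewrite lee_fin mulr_ge0 ?enorm_ge0.
apply: (@le_trans _ _ (\int[gam]_z (enorm z * u z)%:E +
    \int[gam]_z (enorm z * v z)%:E)).
  by apply: leeD; apply: gee_pMl => //; rewrite ?lee_fin ?n0//.
rewrite -ge0_integralD//; last 4 first.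
- by move=> z _; rewrite lee_fin mulr_ge0 ?enorm_ge0.
- by apply/measurable_EFinP; exact: measurable_funM.
- by move=> z _; rewrite lee_fin mulr_ge0 ?enorm_ge0.
- by apply/measurable_EFinP; exact: measurable_funM.
by under eq_integral do rewrite -EFinD -mulrDr uv.
Qed.

(** The vector [m] is the point from which distances are measured: the bound
    is a weighted total variation distance, with weight the norm [enorm z] of the
    displacement of [vadd z m] from [m]. *)
Lemma wasserstein1_le_density (mu nu : {measure set T -> \bar R}) :
    (forall A, measurable A ->
      mu A = \int[gam]_z ((\1_A (vadd z m))%:E * (h1 z)%:E)) ->
    (forall A, measurable A ->
      nu A = \int[gam]_z ((\1_A (vadd z m))%:E * (h2 z)%:E)) ->
  wasserstein1 mu nu <= \int[gam]_z (enorm z * `|h1 z - h2 z|)%:E.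
Proof.
move=> muE nuE.
have rhoT : rho setT = 1.
  rewrite -[setT]/(fst @^-1` setT) marginal1// -int_h1.
  by apply: eq_integral => z _; rewrite indicT mul1e.
(* normalizing by the mass [1] only serves to package [rho] as a probability *)
pose rhoP := mnormalize rho [the probability _ _ of (gam \x gam)%E].
have rhoPE : rhoP = rho by exact: mnormalize_mass1 rhoT.
apply: le_trans cost; apply: ereal_inf_lbound; exists rhoP.
  split=> A mA.
    by rewrite muE// -marginal1//; exact: (congr1 (@^~ _) rhoPE).
  by rewrite nuE// -marginal2//; exact: (congr1 (@^~ _) rhoPE).
rewrite unlock.
exact: (congr1 (fun m => \int[m]_z (enorm (vsub z.1 z.2))%:E) rhoPE).
Qed.

End density_coupling.

(** * Integration against product powers *)

Lemma integral_cst_prob d (T : measurableType d) (R : realType)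
    (P : probability T R) (r : R) : (\int[P]_x r%:E = r%:E)%E.
Proof.
rewrite integral_cst//.
have -> : (P : {measure set T -> \bar R}) setT = 1%E by exact: probability_setT.
by rewrite mule1.
Qed.

Section product_power_integral.
Context d (T : measurableType d) (R : realType).
Local Open Scope ereal_scope.

Lemma ge0_integral_prob_powerS (P : probability T R) n (f : n.+1.-tuple T -> \bar R) :
  (forall t, 0 <= f t) -> measurable_fun setT f ->
  \int[prob_power P n.+1]_t f t =
  \int[P]_x \int[prob_power P n]_t f (tcons (x, t)).
Proof.
move=> f0 mf; rewrite /= ge0_integral_distribution//.
rewrite (fubini_tonelli1 (f \o @tcons d T n))//; last by move=> x; exact: f0.
by apply: (measurableT_comp mf); exact: measurable_tcons.
Qed.

Lemma integral_prob_power0 (P : probability T R) (f : 0.-tuple T -> \bar R) :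
  measurable_fun setT f -> \int[prob_power P 0]_t f t = f [tuple].
Proof. by move=> mf; rewrite /= integral_dirac// diracT mul1e. Qed.

Lemma measurable_prod_tnth n (g : 'I_n -> T -> R) :
  (forall i, measurable_fun setT (g i)) ->
  measurable_fun setT (fun t : n.-tuple T => \prod_(i < n) g i (tnth t i))%R.
Proof.
move=> mg; apply: measurable_prod => i _.
exact: (measurableT_comp (mg i) (measurable_tnth i)).
Qed.

Lemma integral_prod_tnth (P : probability T R) n (g : 'I_n -> T -> R)
    (c : 'I_n -> R) :
  (forall i x, (0 <= g i x)%R) -> (forall i, measurable_fun setT (g i)) ->
  (forall i, \int[P]_x (g i x)%:E = (c i)%:E) ->
  \int[prob_power P n]_t (\prod_(i < n) g i (tnth t i))%:E =
  (\prod_(i < n) c i)%:E.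
Proof.
elim: n g c => [|n IHn] g c g0 mg intg.
  rewrite integral_prob_power0; last first.
    by apply/measurable_EFinP; exact: measurable_prod_tnth.
  by rewrite !big_ord0.
rewrite ge0_integral_prob_powerS; last 2 first.
- by move=> t; rewrite lee_fin prodr_ge0.
- by apply/measurable_EFinP; exact: measurable_prod_tnth.
pose g' i := g (lift ord0 i); pose c' i := c (lift ord0 i).
have mg' i : measurable_fun setT (g' i) by exact: mg.
have c0 : (0 <= \prod_(i < n) c' i)%R.
  apply: prodr_ge0 => i _; rewrite -lee_fin -intg.
  by apply: integral_ge0 => x _; rewrite lee_fin.
transitivity (\int[P]_x ((g ord0 x)%:E * (\prod_(i < n) c' i)%:E)).
  apply: eq_integral => x _; rewrite -(IHn g' c' (fun i => g0 _) mg' (fun i => intg _)).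
  rewrite -ge0_integralZl_EFin//; last 2 first.
  - by move=> t _; rewrite lee_fin prodr_ge0// => i _; exact: g0.
  - by apply/measurable_EFinP; exact: measurable_prod_tnth.
  apply: eq_integral => t _; rewrite big_ord_recl EFinM tnth0.
  by congr (_ * _%:E); apply: eq_bigr => i _; rewrite tnthS.
rewrite ge0_integralZr//; last 2 first.
- exact/measurable_EFinP.
- by move=> x _; rewrite lee_fin.
by rewrite intg -EFinM big_ord_recl.
Qed.

(** A change of variables with density in each coordinate gives one on the
    product, the densities being multiplied. *)
Lemma integral_prob_power_density (P Q : probability T R) n
    (a b : 'I_n -> T -> T) (g : 'I_n -> T -> R) :
  (forall i, measurable_fun setT (a i)) ->
  (forall i, measurable_fun setT (b i)) ->
  (forall i x, (0 <= g i x)%R) -> (forall i, measurable_fun setT (g i)) ->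
  (forall i (f : T -> \bar R), (forall x, 0 <= f x) -> measurable_fun setT f ->
    \int[P]_x f (a i x) = \int[Q]_x (f (b i x) * (g i x)%:E)) ->
  forall f : n.-tuple T -> \bar R, (forall t, 0 <= f t) -> measurable_fun setT f ->
  \int[prob_power P n]_t f [tuple a i (tnth t i) | i < n] =
  \int[prob_power Q n]_t
    (f [tuple b i (tnth t i) | i < n] * (\prod_(i < n) g i (tnth t i))%:E).
Proof.
move=> ma mb g0 mg key.
have mtup k (h : 'I_k -> T -> T) : (forall i, measurable_fun setT (h i)) ->
    measurable_fun setT (fun t : k.-tuple T => [tuple h i (tnth t i) | i < k]).
  move=> mh; apply/measurable_fun_tnthP => i.
  rewrite [X in measurable_fun _ X](_ : _ = fun t => h i (tnth t i)).
    exact: (measurableT_comp (mh i) (measurable_tnth i)).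
  by apply/funext => t /=; rewrite tnth_mktuple.
elim: n a b g ma mb g0 mg key => [|n IHn] a b g ma mb g0 mg key f f0 mf.
  rewrite !integral_prob_power0; last 2 first.
  - apply: emeasurable_funM; first exact: (measurableT_comp mf (mtup _ _ mb)).
    by apply/measurable_EFinP; exact: measurable_prod_tnth.
  - exact: (measurableT_comp mf (mtup _ _ ma)).
  by rewrite big_ord0 mule1; congr f; apply/eq_from_tnth => -[].
pose a' i := a (lift ord0 i); pose b' i := b (lift ord0 i).
pose g' i := g (lift ord0 i).
have ma' i : measurable_fun setT (a' i) by exact: ma.
have mb' i : measurable_fun setT (b' i) by exact: mb.
have mg' i : measurable_fun setT (g' i) by exact: mg.
have tupS (h : 'I_n.+1 -> T -> T) x (t : n.-tuple T) :
    [tuple h i (tnth (tcons (x, t)) i) | i < n.+1] =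
    tcons (h ord0 x, [tuple h (lift ord0 i) (tnth t i) | i < n]).
  apply: eq_from_tnth => i; rewrite tnth_mktuple.
  have [->|[j ->]] : i = ord0 \/ exists j, i = lift ord0 j.
    by case: (unliftP ord0 i) => [j|] ->; [right; exists j|left].
    by rewrite !tnth0.
  by rewrite !tnthS tnth_mktuple.
have mcons (y : T) : measurable_fun setT (fun t : n.-tuple T => tcons (y, t)).
  by apply: (measurableT_comp (@measurable_tcons _ _ n)); exact: measurable_fun_pair.
rewrite !ge0_integral_prob_powerS; last 4 first.
- by move=> t; rewrite mule_ge0// lee_fin prodr_ge0.
- apply: emeasurable_funM; first exact: (measurableT_comp mf (mtup _ _ mb)).
  by apply/measurable_EFinP; exact: measurable_prod_tnth.
- by move=> t.
- exact: (measurableT_comp mf (mtup _ _ ma)).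
(* the change of variables in the last [n] coordinates, the first being [y] *)
pose H y := \int[prob_power Q n]_t (f (tcons (y, [tuple b' i (tnth t i) | i < n])) *
  (\prod_(i < n) g' i (tnth t i))%:E).
have H0 y : 0 <= H y.
  by apply: integral_ge0 => t _; rewrite mule_ge0// lee_fin prodr_ge0// => i _; exact: g0.
have mH : measurable_fun setT H.
  pose F (z : T * n.-tuple T) := f (tcons (z.1, [tuple b' i (tnth z.2 i) | i < n])) *
    (\prod_(i < n) g' i (tnth z.2 i))%:E.
  apply: (@measurable_fun_fubini_tonelli_F _ _ _ _ _ _ F).
    apply: emeasurable_funM.
      apply: (measurableT_comp mf); apply: (measurableT_comp (@measurable_tcons _ _ n)).
      apply: measurable_fun_pair; first exact: measurable_fst.
      exact: (measurableT_comp (mtup _ _ mb') measurable_snd).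
    apply/measurable_EFinP.
    exact: (measurableT_comp (measurable_prod_tnth mg') measurable_snd).
  by move=> z; rewrite mule_ge0// lee_fin prodr_ge0// => i _; exact: g0.
transitivity (\int[P]_x H (a ord0 x)).
  apply: eq_integral => x _; under eq_integral do rewrite tupS.
  rewrite (IHn a' b' g' ma' mb' _ mg' _ (fun t => f (tcons (a ord0 x, t))))//.
  - by move=> i y; exact: g0.
  - by move=> i h h0 mh; exact: key.
  - exact: (measurableT_comp mf (mcons _)).
rewrite key//; apply: eq_integral => x _.
rewrite muleC -ge0_integralZl_EFin//; last 2 first.
- by move=> t _; rewrite mule_ge0// lee_fin prodr_ge0// => i _; exact: g0.
- apply: emeasurable_funM.
    apply: (measurableT_comp mf); exact: (measurableT_comp (mcons _) (mtup _ _ mb')).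
  by apply/measurable_EFinP; exact: measurable_prod_tnth.
apply: eq_integral => t _; rewrite tupS muleCA -EFinM big_ord_recl tnth0.
by congr (_ * _%:E); congr (_ * _)%R; apply: eq_bigr => i _; rewrite tnthS.
Qed.

Lemma integral_tnth (P : probability T R) n (i : 'I_n) (g : T -> R) (c : R) :
  (forall x, (0 <= g x)%R) -> measurable_fun setT g ->
  \int[P]_x (g x)%:E = c%:E ->
  \int[prob_power P n]_t (g (tnth t i))%:E = c%:E.
Proof.
move=> g0 mg intg.
pose G j : T -> R := if j == i then g else cst 1%R.
pose C j : R := if j == i then c else 1%R.
have prodE (F : 'I_n -> R) : (forall j, j != i -> F j = 1%R) ->
    (\prod_(j < n) F j = F i)%R.
  by move=> F1; rewrite (bigD1 i)//= big1 ?mulr1.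
rewrite (_ : c = \prod_(j < n) C j)%R; last first.
  by rewrite prodE /C ?eqxx// => j /negbTE ->.
rewrite -(@integral_prod_tnth P n G C); last 3 first.
- by move=> j x; rewrite /G; case: ifP => // _; exact: ler01.
- by move=> j; rewrite /G; case: ifP.
- move=> j; rewrite /G /C; case: ifP => // _.
  by exact: integral_cst_prob.
apply: eq_integral => t _; rewrite prodE /G ?eqxx// => j /negbTE ->//.
Qed.

Section variance.
Variables (P : probability T R) (g : T -> R) (B mu A : R).
Hypotheses (gB : forall x, (`|g x| <= B)%R) (mg : measurable_fun setT g).
Hypotheses (intg : \int[P]_x (g x)%:E = mu%:E).
Hypotheses (intg2 : \int[P]_x (g x ^+ 2)%:E = A%:E).

Let integrable_le (f : T -> R) (M : R) : measurable_fun setT f ->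
  (forall x, (`|f x| <= M)%R) -> P.-integrable setT (EFin \o f).
Proof.
move=> mf fM.
apply: (@le_integrable _ _ _ _ _ measurableT _ (EFin \o cst M)).
- exact/measurable_EFinP.
- by move=> x _; rewrite /= lee_fin (le_trans (fM x)) ?ler_norm.
- exact: finite_measure_integrable_cst.
Qed.

Let int_shift_sqr (b : R) :
  \int[P]_x (((g x - mu) + b) ^+ 2)%:E <= A%:E + (b ^+ 2)%:E.
Proof.
have ig : P.-integrable setT (EFin \o g) by exact: integrable_le gB.
have ig2 : P.-integrable setT (EFin \o (fun x => g x ^+ 2)%R).
  apply: (integrable_le (M := (B ^+ 2)%R)).
    exact: measurable_funX.
  by move=> x; rewrite normrX lerXn2r ?nnegrE ?normr_ge0// (le_trans _ (gB x)).
have icst (k : R) : P.-integrable setT (EFin \o cst k).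
  exact: finite_measure_integrable_cst.
have iZg : P.-integrable setT (fun x => (2 * (b - mu))%:E * (EFin \o g) x).
  exact: integrableZl.
rewrite (eq_integral (fun x => (EFin \o (fun x => g x ^+ 2)%R) x +
    ((2 * (b - mu))%:E * (EFin \o g) x + (EFin \o cst ((b - mu) ^+ 2)%R) x))); last first.
  by move=> x _ /=; rewrite -EFinM -!EFinD; congr EFin; ring.
rewrite (integralD measurableT ig2 (integrableD measurableT iZg (icst _))).
rewrite (integralD measurableT iZg (icst _)) (integralZl measurableT ig) /=.
rewrite intg intg2 integral_cst_prob.
by rewrite -!EFinM -!EFinD lee_fin; nra.
Qed.

(** Summing one coordinate at a time: the cross term integrates to zero over the
    new coordinate, so each one adds at most the second moment of [g]. *)
Lemma integral_sqr_centered_sum n :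
  \int[prob_power P n]_t ((\sum_(i < n) (g (tnth t i) - mu)) ^+ 2)%:E
    <= (n%:R * A)%:E.
Proof.
have ms k : measurable_fun setT
    (fun t : k.-tuple T => ((\sum_(i < k) (g (tnth t i) - mu)) ^+ 2)%:E).
  apply/measurable_EFinP; apply: measurable_funX; apply: measurable_sum => i.
  apply: measurable_funB => //.
  exact: (measurableT_comp mg (measurable_tnth i)).
have A0 : 0 <= A%:E.
  by rewrite -intg2; apply: integral_ge0 => x _; rewrite lee_fin sqr_ge0.
elim: n => [|n IHn].
  by rewrite integral_prob_power0// big_ord0 expr0n mul0r.
rewrite ge0_integral_prob_powerS//; last by move=> t; rewrite lee_fin sqr_ge0.
rewrite (@fubini_tonelli _ _ _ _ _ P (prob_power P n) (fun z =>
  ((\sum_(i < n.+1) (g (tnth (tcons z) i) - mu)) ^+ 2)%:E)); last 2 first.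
- exact: (measurableT_comp (ms n.+1) (@measurable_tcons _ _ n)).
- by move=> z; rewrite lee_fin sqr_ge0.
apply: (@le_trans _ _ (\int[prob_power P n]_t
    (A%:E + ((\sum_(i < n) (g (tnth t i) - mu)) ^+ 2)%:E))).
  apply: ge0_le_integralT => t.
    by apply: integral_ge0 => x _; rewrite lee_fin sqr_ge0.
  apply: le_trans (int_shift_sqr _); rewrite le_eqVlt; apply/orP; left; apply/eqP.
  apply: eq_integral => x _; rewrite big_ord_recl tnth0.
  by congr ((_ + _) ^+ 2)%:E; apply: eq_bigr => i _; rewrite tnthS.
rewrite ge0_integralD//; last 2 first.
- by move=> t _; rewrite lee_fin sqr_ge0.
- exact: ms.
rewrite integral_cst_prob -natr1 mulrDl mul1r addrC EFinD.
exact: leeD.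
Qed.

Lemma integral_sqr_empirical_mean n : (0 < n)%N ->
  \int[prob_power P n]_t ((n%:R^-1 * (\sum_(i < n) g (tnth t i)) - mu) ^+ 2)%:E
    <= (n%:R^-1 * A)%:E.
Proof.
move=> n0; have n0R : (n%:R != 0 :> R)%R by rewrite pnatr_eq0 -lt0n.
under eq_integral.
  move=> t _.
  rewrite (_ : _ - mu = n%:R^-1 * \sum_(i < n) (g (tnth t i) - mu))%R; last first.
    rewrite sumrB sumr_const card_ord mulrBr -(mulr_natl mu n).
    by rewrite mulrA mulVf// mul1r.
  rewrite exprMn EFinM.
  over.
rewrite ge0_integralZl_EFin//.
- apply: (@le_trans _ _ ((n%:R^-1 ^+ 2)%:E * (n%:R * A)%:E)).
    by rewrite lee_wpmul2l// ?lee_fin ?sqr_ge0//; exact: integral_sqr_centered_sum.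
  by rewrite -EFinM lee_fin expr2 -mulrA [(_ * (n%:R * A))%R]mulrA mulVf// mul1r.
- by move=> t _; rewrite lee_fin sqr_ge0.
- apply/measurable_EFinP; apply: measurable_funX; apply: measurable_sum => i.
  apply: measurable_funB => //.
  exact: (measurableT_comp mg (measurable_tnth i)).
Qed.

End variance.
End product_power_integral.

(** * One-dimensional Gaussian integrals *)

Section gaussian1.
Context {R : realType}.
Local Notation leb := (@lebesgue_measure R).

Definition gauss1 (s : R) : probability R R := [the probability _ _ of
  distribution [the probability _ _ of normal_prob 0 s] of_measurableTypeR].

(** Lebesgue measure is the only measure with its values on half-open intervals,
    on which translation invariance is read off. *)
Lemma ge0_integral_lebesgue_shift (a : R) (f : R -> \bar R) :
  (forall x, (0 <= f x)%E) -> measurable_fun setT f ->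
  (\int[leb]_x f (x + a)%R = \int[leb]_x f x)%E.
Proof.
move=> f0 mf.
have mshift : measurable_fun (setT : set (measurableTypeR R))
    (fun x : measurableTypeR R => x + a : measurableTypeR R).
  exact: measurable_funD.
rewrite -(ge0_integral_image leb mshift f0 mf).
apply: eq_measure_integral => A mA _; apply/esym.
apply: (lebesgue_measure_unique (mu := image_measure leb mshift)) => // X [[x y] xy <-].
rewrite /image_measure /pushforward /=.
rewrite (_ : _ @^-1` _ = `]x - a, y - a]%classic); last first.
  by apply/seteqP; split => z /=; rewrite !in_itv/= ltrBlDr lerBrDr.
rewrite !lebesgue_measure_itv /= !lte_fin ltrD2r; case: ifP => // _.
by rewrite -!EFinB; congr EFin; ring.
Qed.

(** Completing the square shows the integrand to be a multiple of the normal
    density of mean [B / (2 * A)] and variance [1 / (2 * A)]. *)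
Lemma integral_lebesgue_expR_quadratic (A B : R) : 0 < A ->
  (\int[leb]_x (expR (- A * x ^+ 2 + B * x))%:E =
   (Num.sqrt (pi / A) * expR (B ^+ 2 / (4 * A)))%:E)%E.
Proof.
move=> A0; pose s := (Num.sqrt (2 * A))^-1; pose m := B / (2 * A).
have s0 : s != 0 by rewrite invr_neq0// sqrtr_eq0 -ltNge mulr_gt0.
have s2 : s ^+ 2 = (2 * A)^-1 by rewrite exprVn sqr_sqrtr// mulr_ge0// ltW.
have peakE : normal_peak s = (Num.sqrt (pi / A))^-1.
  by rewrite /normal_peak s2; congr (Num.sqrt _)^-1; field; rewrite gt_eqF.
have := integral_normal_pdf m s; rewrite normal_pdfE// => int1.
transitivity (\int[leb]_x ((Num.sqrt (pi / A) * expR (B ^+ 2 / (4 * A)))%:E *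
    (normal_peak s * normal_fun m s x)%:E))%E.
  apply: eq_integral => x _; rewrite -EFinM; congr EFin.
  rewrite peakE mulrACA mulfV ?mul1r; last first.
    by rewrite sqrtr_eq0 -ltNge divr_gt0// pi_gt0.
  rewrite /normal_fun -expRD; congr expR; rewrite s2 /m; field.
  by rewrite gt_eqF.
rewrite ge0_integralZl_EFin//.
- by rewrite int1 mule1.
- by move=> x _; rewrite lee_fin mulr_ge0 ?normal_peak_ge0 ?expR_ge0.
- apply/measurable_EFinP; apply: measurable_funM => //.
  exact: measurable_normal_fun.
Qed.

Lemma ge0_integral_gauss1 (s : R) (f : R -> \bar R) :
  (forall x, (0 <= f x)%E) -> measurable_fun setT f ->
  (\int[gauss1 s]_x f x = \int[leb]_x (f x * (normal_pdf 0 s x)%:E))%E.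
Proof.
move=> f0 mf; rewrite ge0_integral_distribution//.
apply: ge0_integral_density => //.
- by move=> x; exact: normal_pdf_ge0.
- exact: measurable_normal_pdf.
Qed.

Lemma measurable_expR_quadratic (a b c : R) :
  measurable_fun setT (fun x : R => expR (a * x ^+ 2 + b * x + c)).
Proof.
apply: measurableT_comp => //; apply: measurable_funD => //.
apply: measurable_funD; apply: measurable_funM => //.
Qed.

(** Multiplying by [exp (b x^2 + t x)] turns the Gaussian weight into another
    quadratic exponential, integrable as long as [2 b s^2 < 1]. *)
Lemma integral_gauss1_expR_quadratic (s b t c : R) : 0 < s -> 2 * b * s ^+ 2 < 1 ->
  (\int[gauss1 s]_x (expR (b * x ^+ 2 + t * x + c))%:E =
   ((Num.sqrt (1 - 2 * b * s ^+ 2))^-1 *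
     expR (t ^+ 2 * s ^+ 2 / (2 * (1 - 2 * b * s ^+ 2)) + c))%:E)%E.
Proof.
move=> s0 bs; have sn0 : s != 0 by rewrite gt_eqF.
rewrite ge0_integral_gauss1; last 2 first.
- by move=> x; rewrite lee_fin expR_ge0.
- by apply/measurable_EFinP; exact: measurable_expR_quadratic.
pose A := (1 - 2 * b * s ^+ 2) / (2 * s ^+ 2).
have bs' : 0 < 1 - 2 * b * s ^+ 2 by rewrite subr_gt0.
have A0 : 0 < A by rewrite divr_gt0// mulr_gt0// exprn_gt0.
transitivity (\int[leb]_x ((normal_peak s * expR c)%:E *
    (expR (- A * x ^+ 2 + t * x))%:E))%E.
  apply: eq_integral => x _; rewrite normal_pdfE// -!EFinM; congr EFin.
  rewrite mulrCA -mulrA; congr (_ * _); rewrite /normal_fun -!expRD.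
  by congr expR; rewrite /A; field.
rewrite ge0_integralZl_EFin//; last 2 first.
- apply/measurable_EFinP; have := measurable_expR_quadratic (- A) t 0.
  by under eq_fun do rewrite addr0.
- by rewrite mulr_ge0 ?normal_peak_ge0 ?expR_ge0.
rewrite integral_lebesgue_expR_quadratic// -EFinM; congr EFin.
rewrite expRD /normal_peak.
have -> : pi / A = (s ^+ 2 * pi *+ 2) / (1 - 2 * b * s ^+ 2).
  by rewrite /A; field; rewrite gt_eqF//= sn0.
have pk : 0 < s ^+ 2 * pi *+ 2 by rewrite mulrn_wgt0// mulr_gt0 ?pi_gt0// exprn_gt0.
rewrite sqrtrM; last exact: ltW.
rewrite sqrtrV; last exact: ltW.
have -> : t ^+ 2 / (4 * A) = t ^+ 2 * s ^+ 2 / (2 * (1 - 2 * b * s ^+ 2)).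
  by rewrite /A; field; rewrite gt_eqF//= sn0.
have : Num.sqrt (s ^+ 2 * pi *+ 2) != 0 by rewrite sqrtr_eq0 -ltNge.
have : Num.sqrt (1 - 2 * b * s ^+ 2) != 0 by rewrite sqrtr_eq0 -ltNge.
move: (Num.sqrt _) => U; move: (Num.sqrt _) => V U0 V0.
by field; rewrite U0 V0.
Qed.

(** From [1 + b x^2 <= exp (b x^2)] and the previous formula, letting [b] tend
    to [0]. *)
Lemma integral_gauss1_sqr_le (s : R) : 0 < s ->
  (\int[gauss1 s]_x (x ^+ 2)%:E <= (s ^+ 2)%:E)%E.
Proof.
move=> s0; have s20 : 0 < s ^+ 2 by rewrite exprn_gt0.
have key (b : R) : 0 < b -> b * s ^+ 2 <= 4^-1 ->
    (\int[gauss1 s]_x (x ^+ 2)%:E <= (s ^+ 2 + 4 * b * s ^+ 4)%:E)%E.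
  move=> b0 bs; set y := b * s ^+ 2 in bs.
  have y0 : 0 < y by rewrite mulr_gt0.
  (* [1 + y + 4 * y ^+ 2] dominates [(1 - 2 * y) ^ (- 1 / 2)] for [y <= 1 / 4] *)
  have : (1 + b%:E * \int[gauss1 s]_x (x ^+ 2)%:E <=
      (1 + y + 4 * y ^+ 2)%:E)%E.
    apply: (@le_trans _ _ (\int[gauss1 s]_x (expR (b * x ^+ 2 + 0 * x + 0))%:E)%E).
      have mx2 : measurable_fun setT (fun x : R => (x ^+ 2)%:E).
        by apply/measurable_EFinP; exact: exprn_measurable.
      rewrite -(integral_cst_prob (gauss1 s) 1) -ge0_integralZl_EFin//; last 2 first.
      - by move=> x _; rewrite lee_fin sqr_ge0.
      - exact: ltW.
      rewrite -ge0_integralD//; last 2 first.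
      - by move=> x _; rewrite mule_ge0 ?lee_fin ?sqr_ge0 ?ltW.
      - by apply: emeasurable_funM.
      apply: ge0_le_integralT => x.
        by rewrite -EFinM -EFinD lee_fin addr_ge0// mulr_ge0 ?sqr_ge0 ?ltW.
      by rewrite -EFinM -EFinD lee_fin mul0r !addr0 expR_ge1Dx.
    have y2 : 2 * b * s ^+ 2 = 2 * y by rewrite /y mulrA.
    rewrite integral_gauss1_expR_quadratic// ?y2; last first.
      by apply: (@le_lt_trans _ _ (2 * 4^-1)); [rewrite ler_pM2l|lra].
    rewrite expr0n/= !mul0r addr0 expR0 mulr1 lee_fin.
    have q0 : 0 < 1 - 2 * y by lra.
    have p0 : 0 <= 1 + y + 4 * y ^+ 2 by nra.
    have sq0 : 0 < Num.sqrt (1 - 2 * y) by rewrite sqrtr_gt0.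
    rewrite -(ler_pM2r sq0) mulVf ?gt_eqF// -[leLHS]sqrtr1.
    rewrite -(ger0_norm p0) -sqrtr_sqr -sqrtrM ?sqr_ge0// ler_sqrt; last first.
      by rewrite mulr_ge0 ?sqr_ge0 ?ltW.
    rewrite -subr_ge0.
    rewrite (_ : _ - 1 = y ^+ 2 * (5 - 10 * y - 32 * y ^+ 3)); last ring.
    by rewrite mulr_ge0 ?sqr_ge0//; nra.
  have s4 : s ^+ 2 + 4 * b * s ^+ 4 = b^-1 * (y + 4 * y ^+ 2).
    by rewrite /y; field; rewrite gt_eqF.
  have I0 : (0 <= \int[gauss1 s]_x (x ^+ 2)%:E)%E.
    by apply: integral_ge0 => x _; rewrite lee_fin sqr_ge0.
  move: I0; case: (\int[gauss1 s]_x (x ^+ 2)%:E)%E => [r r0|_|//].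
    rewrite -EFinM -EFinD !lee_fin s4 => h.
    by rewrite ler_pdivlMl//; lra.
  by rewrite gt0_muley ?lte_fin// addey.
apply/lee_addgt0Pr => e e0.
pose b := Num.min (4^-1 / s ^+ 2) (e / (4 * s ^+ 4)).
have s40 : 0 < s ^+ 4 by rewrite exprn_gt0.
have b0 : 0 < b by rewrite lt_min !divr_gt0// mulr_gt0.
apply: le_trans (key b b0 _) _; first by rewrite -ler_pdivlMr// ge_min lexx.
rewrite -EFinD lee_fin lerD2l mulrAC mulrC -ler_pdivlMr ?mulr_gt0//.
by rewrite ge_min lexx orbT.
Qed.

End gaussian1.

Section gaussian_ratio.
Context {R : realType}.
Variables sigma s : R.
Hypotheses (sigma0 : 0 < sigma) (s0 : 0 < s).

(** The density of N(u, sigma^2) with respect to N(0, s^2). *)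
Definition gauss_ratio (u z : R) : R :=
  s / sigma * expR (z ^+ 2 / (2 * s ^+ 2) - (z - u) ^+ 2 / (2 * sigma ^+ 2)).

Lemma gauss_ratio_ge0 u z : 0 <= gauss_ratio u z.
Proof. by rewrite mulr_ge0 ?expR_ge0// divr_ge0 ?ltW. Qed.

Lemma gauss_ratio_le u z :
  gauss_ratio u z <= s / sigma * expR (z ^+ 2 / (2 * s ^+ 2)).
Proof.
apply: ler_wpM2l; first by rewrite divr_ge0 ?ltW.
rewrite ler_expR gerBl.
by rewrite divr_ge0 ?sqr_ge0// mulr_ge0// sqr_ge0.
Qed.

Lemma measurable_gauss_ratio d (T : measurableType d) (f g : T -> R) :
  measurable_fun setT f -> measurable_fun setT g ->
  measurable_fun setT (fun t => gauss_ratio (f t) (g t)).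
Proof.
move=> mf mg; apply: measurable_funM => //.
apply: measurableT_comp => //; apply: measurable_funB; apply: measurable_funM => //.
  exact: measurable_funX.
by apply: measurable_funX; exact: measurable_funB.
Qed.

Lemma normal_pdf_ratio u z :
  normal_pdf 0 sigma (z - u) = gauss_ratio u z * normal_pdf 0 s z.
Proof.
rewrite !normal_pdfE ?gt_eqF// /gauss_ratio /normal_fun mulrACA -expRD.
have peakE r : 0 < r -> normal_peak r = r^-1 * (Num.sqrt (pi *+ 2))^-1.
  move=> r0; rewrite /normal_peak -mulrnAr sqrtrM ?sqr_ge0// sqrtr_sqr gtr0_norm//.
  by rewrite invfM.
rewrite !peakE//; congr (_ * expR _); last by field; rewrite !gt_eqF.
by field; rewrite !gt_eqF// sqrtr_gt0 mulrn_wgt0// pi_gt0.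
Qed.

(** [x + y] with [y] of law N(0, sigma^2) has the law of [z + m] with [z] weighted
    by the density of N(x - m, sigma^2). *)
Lemma integral_gauss1_change (x m : R) (f : R -> \bar R) :
  (forall z, (0 <= f z)%E) -> measurable_fun setT f ->
  (\int[gauss1 sigma]_y f (x + y)%R =
   \int[gauss1 s]_z (f (z + m)%R * (gauss_ratio (x - m) z)%:E))%E.
Proof.
move=> f0 mf.
have mfD c : measurable_fun setT (fun z : R => f (z + c)%R).
  by apply: (measurableT_comp mf); exact: measurable_funD.
have mpdf c : measurable_fun setT (fun z : R => (normal_pdf 0 sigma (z - c))%:E).
  apply/measurable_EFinP; apply: (measurableT_comp (measurable_normal_pdf _ _)).
  exact: measurable_funB.
pose F z := (f z * (normal_pdf 0 sigma (z - x))%:E)%E.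
have F0 z : (0 <= F z)%E by rewrite mule_ge0 ?lee_fin ?normal_pdf_ge0.
have mF : measurable_fun setT F by apply: emeasurable_funM.
rewrite !ge0_integral_gauss1//; last 3 first.
- by move=> z; rewrite mule_ge0 ?lee_fin ?gauss_ratio_ge0.
- apply: emeasurable_funM => //; apply/measurable_EFinP.
  exact: measurable_gauss_ratio.
- by under eq_fun do rewrite addrC; exact: mfD.
transitivity (\int[lebesgue_measure]_y F (y + x)%R)%E.
  by apply: eq_integral => y _; rewrite /F addrK addrC.
rewrite ge0_integral_lebesgue_shift// -(ge0_integral_lebesgue_shift m F0 mF).
apply: eq_integral => z _; rewrite /F -muleA -EFinM -normal_pdf_ratio.
by congr (_ * (normal_pdf _ _ _)%:E)%E; ring.
Qed.

Lemma integral_gauss_ratio_sqr u : sigma ^+ 2 < 2 * s ^+ 2 ->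
  (\int[gauss1 s]_z (gauss_ratio u z ^+ 2)%:E =
   (s ^+ 2 / (sigma * Num.sqrt (2 * s ^+ 2 - sigma ^+ 2)) *
    expR (u ^+ 2 / (2 * s ^+ 2 - sigma ^+ 2)))%:E)%E.
Proof.
move=> ss; have D0 : 0 < 2 * s ^+ 2 - sigma ^+ 2 by rewrite subr_gt0.
have [sn0 sigman0] : s != 0 /\ sigma != 0 by rewrite !gt_eqF.
pose b := (s ^+ 2)^-1 - (sigma ^+ 2)^-1.
have bE : 1 - 2 * b * s ^+ 2 = (2 * s ^+ 2 - sigma ^+ 2) / sigma ^+ 2.
  by rewrite /b; field; rewrite sn0 sigman0.
transitivity (\int[gauss1 s]_z (((s / sigma) ^+ 2)%:E * (expR (b * z ^+ 2 +
    (2 * u / sigma ^+ 2) * z + (- u ^+ 2 / sigma ^+ 2)))%:E))%E.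
  apply: eq_integral => z _; rewrite -EFinM /gauss_ratio exprMn -expRM_natl.
  congr (_ * expR _)%:E; rewrite /b; field.
  by rewrite sn0 sigman0.
rewrite ge0_integralZl_EFin//; last 2 first.
- by apply/measurable_EFinP; exact: measurable_expR_quadratic.
- exact: sqr_ge0.
rewrite integral_gauss1_expR_quadratic//; last first.
  by rewrite -subr_gt0 bE divr_gt0// exprn_gt0.
rewrite bE -EFinM mulrA; congr (_ * expR _)%:E; last first.
  by field; rewrite sigman0 gt_eqF.
rewrite sqrtrM ?ltW// sqrtrV ?sqr_ge0// sqrtr_sqr gtr0_norm//.
field; rewrite sigman0 /= sqrtr_eq0 -ltNge.
by rewrite D0.
Qed.

End gaussian_ratio.

(** * Exponential square moments of subgaussian distributions *)

Section subgaussian.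
Context {R : realType} {d : nat}.
Local Notation T := (d.-tuple R).

Lemma gaussianE (s : R) : @gaussian R d s = prob_power (gauss1 s) d.
Proof. by []. Qed.

(** If [z] is a standard Gaussian vector then [exp (b * |y| ^ 2)] is the mean of
    [exp (sqrt (2 * b) * <z, y>)]. Exchanging the two integrals, subgaussianity
    bounds the inner one, and a Gaussian integral in [z] remains. *)
Lemma integral_subgaussian_expR_sqr (K b : R) (P : probability T R) :
  subgaussian K P -> 0 <= b -> 2 * (K ^+ 2 * b) < 1 ->
  (\int[P]_x (expR (b * enorm (vsub x (mean P)) ^+ 2))%:E
    <= ((Num.sqrt (1 - 2 * (K ^+ 2 * b)))^-1 ^+ d)%:E)%E.
Proof.
move=> [_ hP] b0 Kb; pose r := Num.sqrt (2 * b).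
have r2 : r ^+ 2 = 2 * b by rewrite sqr_sqrtr// mulr_ge0.
pose Y (x : T) := vsub x (mean P).
have mY : measurable_fun setT Y by exact: measurable_vsub.
pose G (z x : T) : R := \prod_(i < d) expR (r * tnth (Y x) i * tnth z i).
have G0 z x : 0 <= G z x by rewrite prodr_ge0// => i _; exact: expR_ge0.
have mG : measurable_fun setT (fun xz : T * T => (G xz.2 xz.1)%:E).
  apply/measurable_EFinP; apply: measurable_prod => i _.
  apply: measurableT_comp => //; apply: measurable_funM.
    apply: measurable_funM => //.
    apply: (measurableT_comp (measurable_tnth i)).
    exact: (measurableT_comp mY measurable_fst).
  exact: (measurableT_comp (measurable_tnth i) measurable_snd).
have expE x : (expR (b * enorm (Y x) ^+ 2))%:E = (\int[gaussian 1]_z (G z x)%:E)%E.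
  rewrite gaussianE (integral_prod_tnth (g := fun i z => expR (r * tnth (Y x) i * z))
    (c := fun i => expR (b * tnth (Y x) i ^+ 2))); last 3 first.
  - by move=> i z; exact: expR_ge0.
  - move=> i; have := measurable_expR_quadratic 0 (r * tnth (Y x) i) 0.
    by under eq_fun do rewrite mul0r add0r addr0.
  - move=> i.
    have := @integral_gauss1_expR_quadratic R 1 0 (r * tnth (Y x) i) 0 ltr01.
    rewrite mulr0 mul0r => /(_ ltr01).
    under eq_integral do rewrite mul0r add0r addr0.
    rewrite subr0 sqrtr1 invr1 mul1r addr0 mulr1 expr1n mulr1 exprMn r2 => ->.
    by congr (expR _)%:E; field.
  by rewrite -expR_sum enorm_sqr mulr_sumr.
under eq_integral do rewrite expE.
rewrite (@fubini_tonelli _ _ _ _ _ P (gaussian 1) (fun xz => (G xz.2 xz.1)%:E)); last 2 first.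
- exact: mG.
- by move=> z; rewrite lee_fin.
apply: (@le_trans _ _ (\int[gaussian 1]_z
    (\prod_(i < d) expR (K ^+ 2 * b * tnth z i ^+ 2))%:E)%E).
  apply: ge0_le_integralT => z.
    by apply: integral_ge0 => x _; rewrite lee_fin.
  pose a : T := [tuple r * tnth z i | i < d].
  have -> : \prod_(i < d) expR (K ^+ 2 * b * tnth z i ^+ 2) =
      expR (2^-1 * K ^+ 2 * enorm a ^+ 2).
    rewrite -expR_sum enorm_sqr mulr_sumr; congr expR; apply: eq_bigr => i _.
    by rewrite tnth_mktuple exprMn r2; field.
  apply: le_trans (hP a); rewrite unlock le_eqVlt; apply/orP; left; apply/eqP.
  apply: eq_integral => x _; rewrite /G -expR_sum /dotp; congr (expR _)%:E.
  by apply: eq_bigr => i _; rewrite [tnth a i]tnth_mktuple mulrAC.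
rewrite gaussianE (integral_prod_tnth (g := fun i (z : R) => expR (K ^+ 2 * b * z ^+ 2))
  (c := fun=> (Num.sqrt (1 - 2 * (K ^+ 2 * b)))^-1)); last 3 first.
- by move=> i z; exact: expR_ge0.
- move=> i; have := measurable_expR_quadratic (K ^+ 2 * b) 0 0.
  by under eq_fun do rewrite mul0r !addr0.
- move=> i; have := @integral_gauss1_expR_quadratic R 1 (K ^+ 2 * b) 0 0 ltr01.
  rewrite expr1n mulr1 => /(_ Kb).
  under eq_integral do rewrite mul0r !addr0.
  by rewrite expr0n/= !mul0r addr0 expR0 mulr1.
by rewrite prodr_const card_ord.
Qed.

End subgaussian.

(** * Densities of the smoothed measures *)

Section smoothed_density.
Context {R : realType} {d : nat}.
Local Notation T := (d.-tuple R).
Variables (sigma s : R) (m : T).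
Hypotheses (sigma0 : 0 < sigma) (s0 : 0 < s).
Local Notation gam := (@gaussian R d s).

(** At [z], the density at [z + m] of N(x, sigma^2 I) with respect to
    N(m, s^2 I). *)
Definition ratio (x z : T) : R :=
  \prod_(i < d) gauss_ratio sigma s (tnth x i - tnth m i) (tnth z i).

(** Finite and independent of [x]: as a function of the sample point, the density
    at a fixed [z] is bounded, hence has all its moments under any law. *)
Definition ratio_bound (z : T) : R :=
  \prod_(i < d) (s / sigma * expR (tnth z i ^+ 2 / (2 * s ^+ 2))).

Lemma ratio_ge0 x z : 0 <= ratio x z.
Proof. by apply: prodr_ge0 => i _; exact: gauss_ratio_ge0. Qed.

Lemma ratio_le x z : ratio x z <= ratio_bound z.
Proof.
by apply: ler_prod => i _; rewrite gauss_ratio_ge0//= gauss_ratio_le.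
Qed.

Lemma measurable_ratio d' (U : measurableType d') (f g : U -> T) :
  measurable_fun setT f -> measurable_fun setT g ->
  measurable_fun setT (fun t => ratio (f t) (g t)).
Proof.
move=> mf mg; apply: measurable_prod => i _; apply: measurable_gauss_ratio.
  apply: measurable_funB => //.
  exact: (measurableT_comp (measurable_tnth i) mf).
exact: (measurableT_comp (measurable_tnth i) mg).
Qed.

Lemma measurable_indic_vadd (A : set T) : measurable A ->
  measurable_fun setT (fun z : T => \1_A (vadd z m) : R).
Proof.
move=> mA; apply: (@measurableT_comp _ _ _ _ _ _ (\1_A : T -> R) _
  (fun z : T => vadd z m)); first exact: measurable_indic.
exact: measurable_vadd.
Qed.

Lemma gaussian_shift_density (x : T) (A : set T) : measurable A ->
  gaussian sigma (vadd x @^-1` A) =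
  (\int[gam]_z ((\1_A (vadd z m))%:E * (ratio x z)%:E))%E.
Proof.
move=> mA.
have mpre : measurable (vadd x @^-1` A).
  by rewrite -[X in measurable X]setTI; exact: (measurable_vadd (f := cst x)).
transitivity (\int[gaussian sigma]_y (\1_A (vadd x y))%:E)%E.
  by have := integral_indic (gaussian sigma) measurableT mpre; rewrite setIT => <-.
rewrite !gaussianE; apply: (integral_prob_power_density
  (a := fun i y => tnth x i + y) (b := fun i z => z + tnth m i)
  (g := fun i z => gauss_ratio sigma s (tnth x i - tnth m i) z)
  _ _ _ _ _ (f := fun t => (\1_A t)%:E)).
- by move=> i; exact: measurable_funD.
- by move=> i; exact: measurable_funD.
- by move=> i z; exact: gauss_ratio_ge0.
- by move=> i; exact: measurable_gauss_ratio.
- by move=> i f f0 mf; exact: integral_gauss1_change.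
- by move=> t; rewrite lee_fin.
- by apply/measurable_EFinP; exact: measurable_indic.
Qed.

Lemma convolutionE (mu : {measure set T -> \bar R}) (A : set T) :
  convolution mu (gaussian sigma) A =
  (\int[mu]_x gaussian sigma (vadd x @^-1` A))%E.
Proof.
rewrite /convolution /pushforward /product_measure1/=.
by apply: eq_integral => x _; congr (gaussian sigma _); rewrite xsectionE.
Qed.

Definition mean_ratio (P : probability T R) (z : T) : R :=
  fine (\int[P]_x (ratio x z)%:E)%E.

Lemma mean_ratioE (P : probability T R) (z : T) :
  (\int[P]_x (ratio x z)%:E = (mean_ratio P z)%:E)%E.
Proof.
rewrite fineK// ge0_fin_numE; last first.
  by apply: integral_ge0 => x _; rewrite lee_fin ratio_ge0.
apply: (@le_lt_trans _ _ (ratio_bound z)%:E); last exact: ltry.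
rewrite -(integral_cst_prob P (ratio_bound z)); apply: ge0_le_integralT => x.
  by rewrite lee_fin ratio_ge0.
by rewrite lee_fin ratio_le.
Qed.

Lemma mean_ratio_ge0 (P : probability T R) (z : T) : 0 <= mean_ratio P z.
Proof. by apply: fine_ge0; apply: integral_ge0 => x _; rewrite lee_fin ratio_ge0. Qed.

Lemma measurable_mean_ratio (P : probability T R) :
  measurable_fun setT (mean_ratio P).
Proof.
apply/measurable_EFinP.
rewrite (_ : _ \o _ = fun z => \int[P]_x (ratio x z)%:E)%E; last first.
  by apply/funext => z; rewrite mean_ratioE.
apply: (measurable_fun_fubini_tonelli_F (m2 := P) (fun zx : T * T => (ratio zx.2 zx.1)%:E)).
  apply/measurable_EFinP.
  exact: measurable_ratio measurable_snd measurable_fst.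
by move=> z; rewrite lee_fin ratio_ge0.
Qed.

Lemma convolution_density (P : probability T R) (A : set T) : measurable A ->
  convolution P (gaussian sigma) A =
  (\int[gam]_z ((\1_A (vadd z m))%:E * (mean_ratio P z)%:E))%E.
Proof.
move=> mA; rewrite convolutionE.
under eq_integral do rewrite gaussian_shift_density//.
rewrite (@fubini_tonelli _ _ _ _ _ P gam
  (fun xz => ((\1_A (vadd xz.2 m))%:E * (ratio xz.1 xz.2)%:E)%E)); last 2 first.
- apply: emeasurable_funM; apply/measurable_EFinP.
    exact: (measurableT_comp (measurable_indic_vadd mA) measurable_snd).
  exact: measurable_ratio measurable_fst measurable_snd.
- by move=> xz; rewrite mule_ge0 ?lee_fin ?ratio_ge0.
apply: eq_integral => z _ /=; rewrite ge0_integralZl_EFin//.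
- by rewrite mean_ratioE.
- by move=> x _; rewrite lee_fin ratio_ge0.
- by apply/measurable_EFinP; exact: measurable_ratio.
Qed.

Definition empirical_ratio n (t : n.-tuple T) (z : T) : R :=
  n%:R^-1 * \sum_(i < n) ratio (tnth t i) z.

Lemma empirical_ratio_ge0 n (t : n.-tuple T) (z : T) : 0 <= empirical_ratio t z.
Proof.
by rewrite mulr_ge0 ?invr_ge0// sumr_ge0// => i _; exact: ratio_ge0.
Qed.

Lemma measurable_empirical_ratio n d' (U : measurableType d')
    (f : U -> n.-tuple T) (g : U -> T) :
  measurable_fun setT f -> measurable_fun setT g ->
  measurable_fun setT (fun t => empirical_ratio (f t) (g t)).
Proof.
move=> mf mg; apply: measurable_funM => //; apply: measurable_sum => i.
apply: measurable_ratio => //.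
exact: (measurableT_comp (measurable_tnth i) mf).
Qed.

End smoothed_density.

Lemma ge0_integral_empirical d (T : measurableType d) (R : realType) n
    (t : n.-tuple T) (f : T -> \bar R) :
  (forall x, (0 <= f x)%E) -> measurable_fun setT f ->
  (\int[empirical (R := R) t]_x f x = (n%:R^-1)%:E * \sum_(i < n) f (tnth t i))%E.
Proof.
move=> f0 mf.
pose m k : {measure set T -> \bar R} :=
  if @insub _ _ 'I_n k is Some i then \d_(tnth t i) else mzero.
have n0 : (0 <= n%:R^-1 :> R)%R by rewrite invr_ge0.
have E : empirical t = mscale (NngNum n0) (msum m n).
  apply/funext => A; rewrite /empirical /mscale /msum /=; congr (_ * _)%E.
  by apply: eq_bigr => i _; rewrite /m valK.
transitivity (\int[mscale (NngNum n0) (msum m n)]_x f x)%E.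
  exact: (congr1 (fun mu => \int[mu]_x f x)%E E).
rewrite ge0_integral_mscale// ge0_integral_measure_sum//; congr (_ * _)%E.
apply: eq_bigr => i _; rewrite /m valK integral_dirac//.
by rewrite diracT mul1e.
Qed.

Section empirical_density.
Context {R : realType} {d : nat}.
Local Notation T := (d.-tuple R).
Variables (sigma s : R) (m : T).
Hypotheses (sigma0 : 0 < sigma) (s0 : 0 < s).
Local Notation gam := (@gaussian R d s).
Local Notation ratio := (ratio sigma s m).

Lemma convolution_empirical_density n (t : n.-tuple T) (A : set T) : measurable A ->
  convolution (empirical t) (gaussian sigma) A =
  (\int[gam]_z ((\1_A (vadd z m))%:E * (empirical_ratio sigma s m t z)%:E))%E.
Proof.
move=> mA; rewrite convolutionE.
under eq_integral do rewrite (gaussian_shift_density m sigma0 s0)//.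
have mI := measurable_indic_vadd m mA.
have F0 x z : (0 <= (\1_A (vadd z m))%:E * (ratio x z)%:E)%E.
  by rewrite mule_ge0 ?lee_fin ?ratio_ge0.
rewrite ge0_integral_empirical; last 2 first.
- by move=> x; apply: integral_ge0.
- apply: (measurable_fun_fubini_tonelli_F (m2 := gam)
    (fun xz : T * T => (\1_A (vadd xz.2 m))%:E * (ratio xz.1 xz.2)%:E)%E) => //.
  apply: emeasurable_funM; apply/measurable_EFinP.
    exact: (measurableT_comp mI measurable_snd).
  exact: measurable_ratio measurable_fst measurable_snd.
rewrite -ge0_integral_sum//; last first.
  move=> i; apply: emeasurable_funM; apply/measurable_EFinP => //.
  exact: measurable_ratio.
rewrite -ge0_integralZl_EFin//; last 2 first.
- by move=> z _; apply: sume_ge0.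
- apply: emeasurable_sum => i; apply: emeasurable_funM; apply/measurable_EFinP => //.
  exact: measurable_ratio.
apply: eq_integral => z _; rewrite /empirical_ratio -ge0_sume_distrr; last first.
  by move=> i _; rewrite lee_fin ratio_ge0.
by rewrite muleCA EFinM sumEFin.
Qed.

Lemma integral_mean_ratio (P : probability T R) :
  (\int[gam]_z (mean_ratio sigma s m P z)%:E = 1)%E.
Proof.
transitivity (convolution P (gaussian sigma) setT).
  rewrite (convolution_density m sigma0 s0)//.
  by apply: eq_integral => z _; rewrite indicT mul1e.
rewrite convolutionE; under eq_integral do rewrite preimage_setT probability_setT.
exact: integral_cst_prob.
Qed.

Lemma integral_empirical_ratio n (t : n.-tuple T) : (0 < n)%N ->
  (\int[gam]_z (empirical_ratio sigma s m t z)%:E = 1)%E.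
Proof.
move=> n0; transitivity (convolution (empirical t) (gaussian sigma) setT).
  rewrite convolution_empirical_density//.
  by apply: eq_integral => z _; rewrite indicT mul1e.
rewrite convolutionE; under eq_integral do rewrite preimage_setT probability_setT.
rewrite ge0_integral_empirical// sumEFin sumr_const card_ord -EFinM.
by rewrite mulVf// pnatr_eq0 -lt0n.
Qed.

Lemma wasserstein1_smoothed_le n (t : n.-tuple T) (P : probability T R) : (0 < n)%N ->
  (wasserstein1 (convolution (empirical t) (gaussian sigma))
                (convolution P (gaussian sigma))
   <= \int[gam]_z (enorm z *
        `|empirical_ratio sigma s m t z - mean_ratio sigma s m P z|)%:E)%E.
Proof.
move=> n0; apply: (wasserstein1_le_density (m := m)).
- by move=> z; exact: empirical_ratio_ge0.
- by move=> z; exact: mean_ratio_ge0.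
- exact: measurable_empirical_ratio.
- exact: measurable_mean_ratio.
- exact: integral_empirical_ratio.
- exact: integral_mean_ratio.
- by move=> A mA; exact: convolution_empirical_density.
- by move=> A mA; exact: convolution_density.
Qed.

End empirical_density.

(** * Second moments and the rate *)

Section second_moments.
Context {R : realType} {d : nat}.
Local Notation T := (d.-tuple R).

Lemma integral_gaussian_enorm_sqr_le (s : R) : 0 < s ->
  (\int[@gaussian R d s]_z (enorm z ^+ 2)%:E <= (d%:R * s ^+ 2)%:E)%E.
Proof.
move=> s0; under eq_integral do rewrite enorm_sqr -sumEFin.
rewrite ge0_integral_sum//; last 2 first.
- move=> i; apply/measurable_EFinP; apply: measurable_funX.
  exact: measurable_tnth.
- by move=> i z _; rewrite lee_fin sqr_ge0.
pose c := fine (\int[gauss1 s]_x (x ^+ 2)%:E)%E.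
have I0 : (0 <= \int[gauss1 s]_x (x ^+ 2)%:E)%E.
  by apply: integral_ge0 => x _; rewrite lee_fin sqr_ge0.
have cE : (\int[gauss1 s]_x (x ^+ 2)%:E = c%:E)%E.
  rewrite fineK// ge0_fin_numE//.
  exact: le_lt_trans (integral_gauss1_sqr_le s0) (ltry _).
have cs : c <= s ^+ 2 by rewrite -lee_fin -cE integral_gauss1_sqr_le.
rewrite (eq_bigr (fun=> c%:E)); last first.
  move=> i _; rewrite gaussianE (integral_tnth i (g := fun x : R => x ^+ 2) _ _ cE)//.
    by move=> x; exact: sqr_ge0.
rewrite sumEFin sumr_const card_ord lee_fin -(mulr_natl c).
by rewrite ler_wpM2l.
Qed.

Variables (sigma s : R) (m : T).
Hypotheses (sigma0 : 0 < sigma) (s0 : 0 < s).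
Local Notation gam := (@gaussian R d s).
Local Notation ratio := (ratio sigma s m).
Local Notation empirical_ratio := (empirical_ratio sigma s m).
Local Notation mean_ratio := (mean_ratio sigma s m).

(** [b * |x - m| ^ 2] with [b] the inverse of [2 * s ^+ 2 - sigma ^+ 2] is what is
    left of the exponents once each coordinate is integrated; the variance [s ^+ 2]
    must exceed half of [sigma ^+ 2] for the square of the density to be
    integrable. *)
Lemma integral_ratio_sqr (x : T) : sigma ^+ 2 < 2 * s ^+ 2 ->
  (\int[gam]_z (ratio x z ^+ 2)%:E =
   ((s ^+ 2 / (sigma * Num.sqrt (2 * s ^+ 2 - sigma ^+ 2))) ^+ d *
     expR ((2 * s ^+ 2 - sigma ^+ 2)^-1 * enorm (vsub x m) ^+ 2))%:E)%E.
Proof.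
move=> ss; under eq_integral do rewrite /ratio -prodrXl.
rewrite gaussianE (integral_prod_tnth
  (g := fun i z => gauss_ratio sigma s (tnth x i - tnth m i) z ^+ 2)
  (c := fun i => s ^+ 2 / (sigma * Num.sqrt (2 * s ^+ 2 - sigma ^+ 2)) *
    expR ((tnth x i - tnth m i) ^+ 2 / (2 * s ^+ 2 - sigma ^+ 2)))); last 3 first.
- by move=> i z; exact: sqr_ge0.
- by move=> i; apply: measurable_funX; exact: measurable_gauss_ratio.
- by move=> i; exact: integral_gauss_ratio_sqr.
rewrite big_split/= prodr_const card_ord -expR_sum enorm_sqr mulr_sumr.
by do 3 f_equal; apply: eq_bigr => i _; rewrite tnth_mktuple mulrC.
Qed.

Lemma integral_prob_power_ratio_sqr_le (P : probability T R) n (z : T) : (0 < n)%N ->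
  (\int[prob_power P n]_t ((empirical_ratio t z - mean_ratio P z) ^+ 2)%:E <=
   (n%:R^-1)%:E * \int[P]_x (ratio x z ^+ 2)%:E)%E.
Proof.
move=> n0; pose A := fine (\int[P]_x (ratio x z ^+ 2)%:E)%E.
have rB x : `|ratio x z| <= ratio_bound sigma s z.
  by rewrite ger0_norm ?ratio_ge0// ratio_le.
have AE : (\int[P]_x (ratio x z ^+ 2)%:E = A%:E)%E.
  rewrite fineK// ge0_fin_numE; last first.
    by apply: integral_ge0 => x _; rewrite lee_fin sqr_ge0.
  apply: (@le_lt_trans _ _ (ratio_bound sigma s z ^+ 2)%:E); last exact: ltry.
  rewrite -(integral_cst_prob P (_ ^+ 2)); apply: ge0_le_integralT => x.
    by rewrite lee_fin sqr_ge0.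
  have r0 : 0 <= ratio x z by exact: ratio_ge0.
  have rb : ratio x z <= ratio_bound sigma s z by exact: ratio_le.
  by rewrite lee_fin; apply: lerXn2r => //; rewrite nnegrE// (le_trans r0).
rewrite AE -EFinM; apply: integral_sqr_empirical_mean AE _ n0.
- exact: rB.
- exact: measurable_ratio.
- exact: mean_ratioE.
Qed.

End second_moments.

Section smoothed_rate.
Context {R : realType} {d : nat}.
Local Notation T := (d.-tuple R).
Variables (sigma K : R) (P : probability T R).
Hypotheses (sigma0 : 0 < sigma) (K0 : 0 < K) (hP : subgaussian K P).
Let s := Num.sqrt (2 * K ^+ 2 + sigma ^+ 2).
Local Notation gam := (@gaussian R d s).
Local Notation ratio := (ratio sigma s (mean P)).
Local Notation empirical_ratio := (empirical_ratio sigma s (mean P)).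
Local Notation mean_ratio := (mean_ratio sigma s (mean P) P).

Let s2E : s ^+ 2 = 2 * K ^+ 2 + sigma ^+ 2.
Proof. by rewrite sqr_sqrtr// addr_ge0 ?sqr_ge0// mulr_ge0// sqr_ge0. Qed.

Let s0 : 0 < s.
Proof. by rewrite sqrtr_gt0 ltr_wpDl ?exprn_gt0// mulr_ge0// sqr_ge0. Qed.

(** With [D = sqrt (4 * K ^+ 2 + sigma ^+ 2)], each coordinate contributes
    [s ^+ 2 / (sigma * D)] from the integral in [z] and [D / s] from the square
    exponential moment of [P]; the choice of [s] makes [D] cancel. *)
Lemma integral_ratio_sqr_le :
  (\int[P]_x \int[gam]_z (ratio x z ^+ 2)%:E <= ((s / sigma) ^+ d)%:E)%E.
Proof.
have D2E : 2 * s ^+ 2 - sigma ^+ 2 = 4 * K ^+ 2 + sigma ^+ 2 by rewrite s2E; ring.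
have D20 : 0 < 2 * s ^+ 2 - sigma ^+ 2.
  by rewrite D2E ltr_wpDl ?exprn_gt0// mulr_ge0// sqr_ge0.
have ss : sigma ^+ 2 < 2 * s ^+ 2 by rewrite -subr_gt0.
set D := 2 * s ^+ 2 - sigma ^+ 2 in D2E D20.
under eq_integral do rewrite integral_ratio_sqr// EFinM.
rewrite ge0_integralZl_EFin//; last 2 first.
- apply/measurable_EFinP; apply: measurableT_comp => //.
  apply: measurable_funM => //; apply: measurable_funX.
  apply: (measurableT_comp (@measurable_enorm R d)); exact: measurable_vsub.
- by rewrite exprn_ge0// divr_ge0 ?sqr_ge0// mulr_ge0// ltW.
rewrite -/D.
have KD : 1 - 2 * (K ^+ 2 * D^-1) = s ^+ 2 / D.
  by rewrite s2E; field: D2E; rewrite gt_eqF.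
apply: (@le_trans _ _ (((s ^+ 2 / (sigma * Num.sqrt D)) ^+ d)%:E *
    ((Num.sqrt (1 - 2 * (K ^+ 2 * D^-1)))^-1 ^+ d)%:E)%E).
  apply: lee_wpmul2l.
    by rewrite lee_fin exprn_ge0// divr_ge0 ?sqr_ge0// mulr_ge0// ltW.
  apply: integral_subgaussian_expR_sqr => //; first by rewrite invr_ge0 ltW.
  by rewrite -subr_gt0 KD divr_gt0// exprn_gt0.
rewrite KD -EFinM -exprMn lee_fin le_eqVlt; apply/orP; left; apply/eqP.
congr (_ ^+ d); rewrite sqrtrM ?sqr_ge0// sqrtr_sqr gtr0_norm// sqrtrV ?ltW//.
by field; rewrite !gt_eqF// sqrtr_gt0.
Qed.


Lemma integral_ratio_deviation_sqr_le n : (0 < n)%N ->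
  (\int[prob_power P n]_t \int[gam]_z
      ((empirical_ratio t z - mean_ratio z) ^+ 2)%:E
    <= ((s / sigma) ^+ d / n%:R)%:E)%E.
Proof.
move=> n0.
have mdev : measurable_fun setT (fun tz : n.-tuple T * T =>
    ((empirical_ratio tz.1 tz.2 - mean_ratio tz.2) ^+ 2)%:E).
  apply/measurable_EFinP; apply: measurable_funX; apply: measurable_funB.
    exact: measurable_empirical_ratio measurable_fst measurable_snd.
  by apply: (measurableT_comp _ measurable_snd); exact: measurable_mean_ratio.
have mr2 : measurable_fun setT (fun zx : T * T => (ratio zx.2 zx.1 ^+ 2)%:E).
  apply/measurable_EFinP; apply: measurable_funX.
  exact: measurable_ratio measurable_snd measurable_fst.
rewrite (@fubini_tonelli _ _ _ _ _ (prob_power P n) gam _ mdev); last first.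
  by move=> tz; rewrite lee_fin sqr_ge0.
apply: (@le_trans _ _ (\int[gam]_z ((n%:R^-1)%:E *
    \int[P]_x (ratio x z ^+ 2)%:E))%E).
  apply: ge0_le_integralT => z.
    by apply: integral_ge0 => t _; rewrite lee_fin sqr_ge0.
  exact: integral_prob_power_ratio_sqr_le.
rewrite ge0_integralZl_EFin//; last 2 first.
- by move=> z _; apply: integral_ge0 => x _; rewrite lee_fin sqr_ge0.
- apply: (measurable_fun_fubini_tonelli_F (m2 := P)
    (fun zx : T * T => (ratio zx.2 zx.1 ^+ 2)%:E)) => // zx.
  by rewrite lee_fin sqr_ge0.
rewrite (@fubini_tonelli _ _ _ _ _ gam P _ mr2); last first.
  by move=> zx; rewrite lee_fin sqr_ge0.
rewrite [leRHS]EFinM muleC lee_wpmul2r ?lee_fin ?invr_ge0//.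
exact: integral_ratio_sqr_le.
Qed.

Lemma wasserstein1_ge0 (mu nu : {measure set T -> \bar R}) :
  (0 <= wasserstein1 mu nu)%E.
Proof.
apply: le_ereal_inf_tmp => _ [pi _ <-].
by apply: expectation_ge0 => z; exact: enorm_ge0.
Qed.

(** Cauchy-Schwarz in the form of the weighted inequality
    [2 r v <= (b / a) r^2 + (a / b) v^2], with the weights that are optimal once
    integrated. *)
Lemma smoothed_wasserstein1_rate n : (0 < d)%N -> (0 < n)%N ->
  (\int[prob_power P n]_t
      wasserstein1 (convolution (empirical t) (gaussian sigma))
                   (convolution P (gaussian sigma))
   <= (Num.sqrt (d%:R * s ^+ 2) * Num.sqrt ((s / sigma) ^+ d / n%:R))%:E)%E.
Proof.
move=> d0 n0; set A := d%:R * s ^+ 2; set B := (s / sigma) ^+ d / n%:R.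
have A0 : 0 < A by rewrite mulr_gt0 ?ltr0n// exprn_gt0.
have B0 : 0 < B by rewrite divr_gt0 ?ltr0n// exprn_gt0// divr_gt0.
set a := Num.sqrt A; set b := Num.sqrt B.
have a0 : 0 < a by rewrite sqrtr_gt0.
have b0 : 0 < b by rewrite sqrtr_gt0.
have a2 : a ^+ 2 = A by rewrite sqr_sqrtr// ltW.
have b2 : b ^+ 2 = B by rewrite sqr_sqrtr// ltW.
pose c1 := b / a / 2; pose c2 := a / b / 2.
have c10 : 0 <= c1 by rewrite !divr_ge0// ltW.
have c20 : 0 <= c2 by rewrite !divr_ge0// ltW.
have amgm r v : r * `|v| <= c1 * r ^+ 2 + c2 * v ^+ 2.
  rewrite -subr_ge0 -(real_normK (num_real v)).
  rewrite (_ : _ - _ = (b * r - a * `|v|) ^+ 2 / (2 * a * b)); last first.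
    by rewrite /c1 /c2; field; rewrite !gt_eqF.
  by rewrite divr_ge0 ?sqr_ge0// !mulr_ge0// ltW.
pose dev (t : n.-tuple T) (z : T) : R := empirical_ratio t z - mean_ratio z.
have mdev : measurable_fun setT (fun tz : n.-tuple T * T => (dev tz.1 tz.2 ^+ 2)%:E).
  apply/measurable_EFinP; apply: measurable_funX; apply: measurable_funB.
    exact: measurable_empirical_ratio measurable_fst measurable_snd.
  by apply: (measurableT_comp _ measurable_snd); exact: measurable_mean_ratio.
have dev0 t : (0 <= \int[gam]_z (dev t z ^+ 2)%:E)%E.
  by apply: integral_ge0 => z _; rewrite lee_fin sqr_ge0.
have mdev1 t : measurable_fun setT (fun z => (dev t z ^+ 2)%:E).
  apply/measurable_EFinP; apply: measurable_funX; apply: measurable_funB.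
    exact: measurable_empirical_ratio.
  exact: measurable_mean_ratio.
have mdev2 : measurable_fun setT (fun t : n.-tuple T => \int[gam]_z (dev t z ^+ 2)%:E)%E.
  apply: (measurable_fun_fubini_tonelli_F (m2 := gam) _ mdev) => tz.
  by rewrite lee_fin sqr_ge0.
have mn2 : measurable_fun setT (fun z : T => (enorm z ^+ 2)%:E).
  by apply/measurable_EFinP; apply: measurable_funX; exact: measurable_enorm.
apply: (@le_trans _ _ (\int[prob_power P n]_t
    ((c1 * A)%:E + c2%:E * \int[gam]_z (dev t z ^+ 2)%:E))%E).
  apply: ge0_le_integralT => t; first exact: wasserstein1_ge0.
  apply: le_trans (wasserstein1_smoothed_le (mean P) sigma0 s0 t P n0) _.
  apply: (@le_trans _ _ (\int[gam]_z
      (c1%:E * (enorm z ^+ 2)%:E + c2%:E * (dev t z ^+ 2)%:E))%E).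
    apply: ge0_le_integralT => z; first by rewrite lee_fin mulr_ge0 ?enorm_ge0.
    by rewrite -!EFinM -EFinD lee_fin; exact: amgm.
  rewrite ge0_integralD//; last 4 first.
  - by move=> z _; rewrite mule_ge0 ?lee_fin ?sqr_ge0.
  - exact: emeasurable_funM.
  - by move=> z _; rewrite mule_ge0 ?lee_fin ?sqr_ge0.
  - exact: emeasurable_funM.
  rewrite !ge0_integralZl_EFin//; last 2 first.
  - by move=> z _; rewrite lee_fin sqr_ge0.
  - by move=> z _; rewrite lee_fin sqr_ge0.
  apply: leeD => //; rewrite [leRHS]EFinM lee_wpmul2l ?lee_fin//.
  exact: integral_gaussian_enorm_sqr_le.
rewrite ge0_integralD//; last 3 first.
- by move=> t _; rewrite lee_fin mulr_ge0// ltW.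
- by move=> t _; rewrite mule_ge0 ?lee_fin.
- exact: emeasurable_funM.
rewrite integral_cst_prob ge0_integralZl_EFin//.
apply: (@le_trans _ _ ((c1 * A)%:E + c2%:E * B%:E)%E).
  by apply: leeD => //; rewrite lee_wpmul2l ?lee_fin//; exact: integral_ratio_deviation_sqr_le.
rewrite -EFinM -EFinD lee_fin -a2 -b2 le_eqVlt; apply/orP; left; apply/eqP.
by rewrite /c1 /c2; field; rewrite !gt_eqF.
Qed.

Let w := (Num.sqrt 2)^-1 + K / sigma.

Let w0 : 0 < w.
Proof. by rewrite addr_gt0 ?divr_gt0// invr_gt0 sqrtr_gt0. Qed.

Let s_le : s <= Num.sqrt 2 * w * sigma.
Proof.
have q0 : 0 < Num.sqrt 2 :> R by rewrite sqrtr_gt0.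
have q2 : Num.sqrt 2 ^+ 2 = 2 :> R by rewrite sqr_sqrtr.
have -> : Num.sqrt 2 * w * sigma = sigma + Num.sqrt 2 * K.
  by rewrite /w; field; rewrite !gt_eqF.
have p0 : 0 <= sigma + Num.sqrt 2 * K by rewrite addr_ge0 ?mulr_ge0 ?ltW.
rewrite -(ger0_norm p0) -sqrtr_sqr ler_wsqrtr// sqrrD exprMn q2 addrC lerD2r.
by rewrite lerDl mulrn_wge0// mulr_ge0 ?mulr_ge0 ?ltW.
Qed.

Let sqrt2_le : Num.sqrt 2 <= expR (3 / 8) :> R.
Proof.
rewrite -(ger0_norm (expR_ge0 (3 / 8))) -sqrtr_sqr ler_wsqrtr//.
rewrite -expRM_natl (_ : 2%:R * (3 / 8) = 8%:R * (3 / 32)); last by field.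
(* [(35 / 32) ^+ 8] is just above [2] *)
rewrite expRM_natl; apply: (@le_trans _ _ ((1 + 3 / 32) ^+ 8)); first by lra.
by apply: lerXn2r; rewrite ?nnegrE ?expR_ge0 ?expR_ge1Dx//; lra.
Qed.

Lemma smoothed_rate_le n : (0 < n)%N ->
  Num.sqrt (d%:R * s ^+ 2) * Num.sqrt ((s / sigma) ^+ d / n%:R) <=
  sigma * Num.sqrt (2 * d%:R) * w `^ (d%:R / 2 + 1) *
    expR (3 * d%:R / 16) * (Num.sqrt n%:R)^-1.
Proof.
move=> n0.
pose q : R := Num.sqrt 2.
have q0 : 0 <= q by exact: sqrtr_ge0.
have sw : s / sigma <= q * w by rewrite ler_pdivrMr.
have first : Num.sqrt (d%:R * s ^+ 2) <= sigma * Num.sqrt (2 * d%:R) * w.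
  rewrite sqrtrM// [leLHS]sqrtrM// sqrtr_sqr gtr0_norm//.
  rewrite (_ : sigma * _ * w = Num.sqrt d%:R * (q * w * sigma)); last by rewrite /q; ring.
  by rewrite ler_wpM2l// sqrtr_ge0.
have expd : Num.sqrt (q ^+ d) <= expR (3 * d%:R / 16).
  rewrite -(ger0_norm (expR_ge0 (3 * d%:R / 16))) -sqrtr_sqr ler_wsqrtr//.
  rewrite -expRM_natl (_ : 2%:R * _ = d%:R * (3 / 8)); last by field.
  by rewrite expRM_natl lerXn2r ?nnegrE ?expR_ge0// sqrt2_le.
have second : Num.sqrt ((s / sigma) ^+ d / n%:R) <=
    expR (3 * d%:R / 16) * w `^ (d%:R / 2) / Num.sqrt n%:R.
  apply: (@le_trans _ _ (Num.sqrt ((q * w) ^+ d / n%:R))).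
    rewrite ler_wsqrtr// ler_wpM2r ?invr_ge0// lerXn2r// nnegrE.
      by rewrite divr_ge0// ltW.
    by rewrite mulr_ge0// ltW.
  have wd : Num.sqrt (w ^+ d) = w `^ (d%:R / 2).
    by rewrite powRrM powR_mulrn ?ltW// powR12_sqrt// exprn_ge0// ltW.
  have qw0 : 0 <= (q * w) ^+ d by rewrite exprn_ge0// mulr_ge0// ltW.
  rewrite (sqrtrM _ qw0) sqrtrV// exprMn (sqrtrM _ (exprn_ge0 d q0)) wd.
  by rewrite ler_wpM2r ?invr_ge0 ?sqrtr_ge0// ler_wpM2r ?powR_ge0.
apply: (le_trans (ler_pM (sqrtr_ge0 _) (sqrtr_ge0 _) first second)).
rewrite powRD ?(gt_eqF w0) ?implybT// (powRr1 (ltW w0)) le_eqVlt; apply/orP; left.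
by apply/eqP; ring.
Qed.

End smoothed_rate.

Theorem proposition1 (R : realType) (d : nat) (sigma K : R)
    (hd : (1 <= d)%N) (hsigma : 0 < sigma) (hK : 0 < K)
    (P : probability (d.-tuple R) R) (hP : subgaussian K P)
    (n : nat) (hn : (1 <= n)%N) :
  (\int[prob_power P n]_s
      wasserstein1 (convolution (empirical s) (gaussian sigma))
                   (convolution P (gaussian sigma))
   <= (sigma * Num.sqrt (2 * d%:R)
       * ((Num.sqrt 2)^-1 + K / sigma) `^ (d%:R / 2 + 1)
       * expR (3 * d%:R / 16)
       * (Num.sqrt n%:R)^-1)%:E)%E.
Proof.
apply: (le_trans (smoothed_wasserstein1_rate hsigma hP hd hn)).
by rewrite lee_fin smoothed_rate_le.
Qed.
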